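(* Let $C\in\mathcal C^2$, let $(U_1,V_1),(U_2,V_2),\dots$ be i.i.d. with distribution function $C$, let $E_n$ be the empirical copula of $(U_1,V_1),\dots,(U_n,V_n)$, fix $s\in(0,\tfrac12)$ and set $N(n)=\lfloor n^s\rfloor$. Then there is an at most countable set $T\subset(0,1)$ such that for every $\tau\in(0,1)\setminus T$, with probability one, $$\lim_{n\to\infty}Q^\tau_{\mathfrak{Cb}_{N(n)}(E_n)}(x)=Q^\tau_C(x)\quad\text{for }\lambda\text{-almost every }x\in\mathbb I,$$ and consequently $\lim_{n\to\infty}\|Q^\tau_{\mathfrak{Cb}_{N(n)}(E_n)}-Q^\tau_C\|_p=0$ for every $p\in[1,\infty)$, where $\|f\|_p=(\int_{\mathbb I}|f|^p\,\mathrm d\lambda)^{1/p}$.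
   Context: $\mathbb I=[0,1]$, $\lambda$ Lebesgue measure. A bivariate copula $C\in\mathcal C^2$ is the distribution function on $\mathbb I^2$ of a probability measure $\mu_C$ with uniform marginals. $K_C(x,\cdot)$ is the Markov kernel (conditional distribution of the second coordinate given the first), $\mu_C(B\times F)=\int_B K_C(x,F)\,\mathrm d\lambda(x)$, and $Q^\tau_C(x)=\inf\{y\in\mathbb I:K_C(x,[0,y])\ge\tau\}$. The empirical copula $E_n$ is the bilinear interpolation of the empirical subcopula induced by the (pseudo-)ranks of the sample. For $N\in\mathbb N$ and $D\in\mathcal C^2$, the checkerboard approximation $\mathfrak{Cb}_N(D)$ is the copula with density $N^2\sum_{i,j=1}^N\mu_D(I_{N,i}\times I_{N,j})\mathbf 1_{I_{N,i}\times I_{N,j}}$, where $I_{N,i}=(\frac{i-1}N,\frac iN)$. *)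

(* Defs.v *)
From HB Require Import structures.
From mathcomp Require Import all_boot all_order all_algebra.
From mathcomp Require Import all_classical all_reals all_analysis.
Set Implicit Arguments. Unset Strict Implicit. Unset Printing Implicit Defensive.
Import Order.TTheory GRing.Theory Num.Theory.
Import numFieldNormedType.Exports.
Local Open Scope classical_set_scope.
Local Open Scope ring_scope.

Section Copulas.
Variable R : realType.

Definition unitI : set R := `[0, 1]%classic.

Definition copula_measure (C : R -> R -> R) (mu : probability (R * R)%type R) : Prop :=
  mu (unitI `*` unitI) = 1%E /\
  forall x y, unitI x -> unitI y -> mu (`[0, x] `*` `[0, y]) = (C x y)%:E.

Definition is_copula (C : R -> R -> R) : Prop :=
  exists mu : probability (R * R)%type R, copula_measure C mu /\
    forall B : set R, measurable B ->
      mu (B `*` setT) = lebesgue_measure (B `&` unitI) /\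
      mu (setT `*` B) = lebesgue_measure (B `&` unitI).

Definition markov_kernel_of (C : R -> R -> R) (K : R.-pker R ~> R) : Prop :=
  exists mu : probability (R * R)%type R, copula_measure C mu /\
    forall B F : set R, measurable B -> measurable F -> B `<=` unitI -> F `<=` unitI ->
      mu (B `*` F) = (\int[lebesgue_measure]_(x in B) K x F)%E.

Definition cquantile (K : R.-pker R ~> R) (tau : R) (x : R) : R :=
  inf [set y | unitI y /\ lee tau%:E (K x (`[0, y]%classic : set R))].

(** sample: (X 0, ..., X (n-1)) = ((U_1,V_1), ..., (U_n,V_n)).
    (Pseudo-)ranks: rank of the k-th first coordinate among the first n. *)
Definition rank1 (xs : nat -> R * R) (n k : nat) : nat :=
  #|[set l : 'I_n | (xs l).1 <= (xs k).1]|.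
Definition rank2 (xs : nat -> R * R) (n k : nat) : nat :=
  #|[set l : 'I_n | (xs l).2 <= (xs k).2]|.

(** empirical subcopula on the grid {0,1/n,...,1}^2 (value at (i/n, j/n)) *)
Definition emp_subcopula (xs : nat -> R * R) (n i j : nat) : R :=
  (#|[set k : 'I_n | (rank1 xs n k <= i)%N && (rank2 xs n k <= j)%N]|%:R) / n%:R.

Definition cell (n : nat) (u : R) : nat := minn (Num.truncn (n%:R * u)) n.-1.
Definition frac (n : nat) (u : R) : R := n%:R * u - (cell n u)%:R.

(** empirical copula E_n: bilinear interpolation of the empirical subcopula *)
Definition emp_copula (xs : nat -> R * R) (n : nat) (u v : R) : R :=
  let i := cell n u in let j := cell n v in
  let a := frac n u in let b := frac n v in
  (1 - a) * (1 - b) * emp_subcopula xs n i j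
  + a * (1 - b) * emp_subcopula xs n i.+1 j
  + (1 - a) * b * emp_subcopula xs n i j.+1
  + a * b * emp_subcopula xs n i.+1 j.+1.

(** mu_D of the square I_{N,i+1} x I_{N,j+1} (0-indexed i, j), i.e. the D-volume *)
Definition cb_mass (N : nat) (D : R -> R -> R) (i j : nat) : R :=
  D (i.+1%:R / N%:R) (j.+1%:R / N%:R) - D (i%:R / N%:R) (j.+1%:R / N%:R)
  - D (i.+1%:R / N%:R) (j%:R / N%:R) + D (i%:R / N%:R) (j%:R / N%:R).

(** N * lambda([0,u] /\ I_{N,i+1}) *)
Definition clamp01 (t : R) : R := Num.min 1 (Num.max 0 t).

(** checkerboard approximation Cb_N(D): the distribution function of the density
    N^2 sum_{i,j} mu_D(I_i x I_j) 1_{I_i x I_j} *)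
Definition checkerboard (N : nat) (D : R -> R -> R) (u v : R) : R :=
  \sum_(i < N) \sum_(j < N)
     cb_mass N D i j * clamp01 (N%:R * u - i%:R) * clamp01 (N%:R * v - j%:R).

Definition Nfloor (s : R) (n : nat) : nat := Num.truncn (n%:R `^ s).

Definition Lp_norm (p : R) (f : R -> R) : \bar R :=
  poweR (\int[lebesgue_measure]_(x in unitI) (`|f x| `^ p)%:E)%E p^-1.

End Copulas.

Definition iid_with_df {R : realType} {d : measure_display} {Omega : measurableType d}
  (P : probability Omega R) (X : nat -> Omega -> R * R) (C : R -> R -> R) : Prop :=
  (forall i, measurable_fun setT (X i)) /\
  (forall (n : nat) (B : nat -> set (R * R)%type), (forall i, measurable (B i)) ->
     P (\bigcap_(i in `I_n) (X i @^-1` B i)) = (\prod_(i < n) P (X i @^-1` B i))%E) /\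
  (forall i u v, unitI u -> unitI v ->
     P [set w | (X i w).1 <= u /\ (X i w).2 <= v] = (C u v)%:E).

(* Main.v *)
(** Discretising the plane at mesh [1/n], a Chernoff bound and Borel-Cantelli show that
    almost surely the empirical distribution function, and hence the empirical copula [E_n],
    is within [O(n^-r)] of [C] uniformly, for any [r < 1/2].  Choose [s < r].

    On the strip (i/N, (i+1)/N) the kernel of [Cb_N(E_n)] at a grid height [j/N] is [N] times
    the [E_n]-volume of the strip below [j/N].  As [N(n) n^-r -> 0], it is asymptotically the
    difference quotient of [C(., j/N)] over a shrinking interval around [x], which by
    Lebesgue differentiation tends to [K(x, [0, y])] for almost every [x] and all rational [y];
    monotonicity in [y] absorbs the rounding of [y] to the grid.

    Quantiles then converge wherever [K(x, [0, .])] has no plateau at height [tau].  A plateau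
    contains a rational [q], so [tau] only has to avoid the atoms of the countably many
    random variables [x |-> K(x, [0, q])].  The [L^p] statement follows by dominated convergence. *)
Require Import Defs.
From HB Require Import structures.
From mathcomp Require Import all_boot all_order all_algebra.
From mathcomp Require Import all_classical all_reals all_analysis.
From mathcomp Require Import measurable_realfun ring lra.
Import Order.TTheory GRing.Theory Num.Theory.
Import numFieldNormedType.Exports.
Local Open Scope classical_set_scope.
Local Open Scope ring_scope.

(** * Deviation of empirical frequencies *)

Section Concentration.
Context {R : realType}.
Implicit Types (p t e x : R) (n : nat).

(** Inverting [1 - x <= expR (- x)] gives [(1 - x) * expR x <= 1], while [(1 - x) * (1 + x + 2 * x
    ^+ 2) = 1 + x ^+ 2 * (1 - 2 * x)] is at least [1] for [x <= 1/2]. *)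
Lemma expR_le_quadratic x : `|x| <= 2^-1 -> expR x <= 1 + x + 2 * x ^+ 2.
Proof.
rewrite ler_norml => /andP[x1 x2].
have := expR_ge1Dx (- x); rewrite expRN => h.
have e0 : 0 < expR x by exact: expR_gt0.
have : (1 - x) * expR x <= 1.
  by rewrite -[leRHS](@mulVf _ (expR x)) ?gt_eqF// ler_wpM2r// ltW.
have x0 : 0 < 1 - x by lra.
move=> h1; rewrite -(ler_pM2l x0).
apply: (le_trans h1).
have -> : (1 - x) * (1 + x + 2 * x ^+ 2) = 1 + x ^+ 2 * (1 - 2 * x) by ring.
by rewrite lerDl mulr_ge0 ?sqr_ge0//; lra.
Qed.

(** Averaging the quadratic bound on [expR], the centring of [c] removes the linear term and leaves
    [1 + 2 * t ^+ 2]. *)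
Lemma bernoulli_mgf_le p t (c : bool -> R) : 0 <= p <= 1 -> `|t| <= 2^-1 ->
  (forall b, `|c b| <= 1) -> p * c true + (1 - p) * c false = 0 ->
  p * expR (t * c true) + (1 - p) * expR (t * c false) <= expR (2 * t ^+ 2).
Proof.
move=> /andP[p0 p1] t1 c1 c0.
have H b : expR (t * c b) <= 1 + t * c b + 2 * t ^+ 2.
  apply: (le_trans (expR_le_quadratic (t * c b) _)).
    by rewrite normrM (le_trans (ler_piMr _ _)).
  rewrite lerD2l ler_pM2l// exprMn ler_piMr ?sqr_ge0//.
  by have := c1 b; rewrite ler_norml => /andP[? ?]; nra.
apply: (@le_trans _ _ (1 + 2 * t ^+ 2)); last exact: expR_ge1Dx.
have Ht := H true; have Hf := H false.
have -> : 1 + 2 * t ^+ 2 =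
   p * (1 + t * c true + 2 * t ^+ 2) + (1 - p) * (1 + t * c false + 2 * t ^+ 2).
  have -> : p * (1 + t * c true + 2 * t ^+ 2) + (1 - p) * (1 + t * c false + 2 * t ^+ 2)
    = 1 + 2 * t ^+ 2 + t * (p * c true + (1 - p) * c false) by ring.
  by rewrite c0 mulr0 addr0.
by apply: lerD; apply: ler_wpM2l => //; lra.
Qed.

Let bernoulli_weight p (b : bool) : R := if b then p else 1 - p.

(* Exponential Markov inequality with the tilt [e / 4]. *)
Lemma bernoulli_chernoff n p e (c : bool -> R) : 0 <= p <= 1 -> 0 <= e <= 1 ->
  (forall b, `|c b| <= 1) -> p * c true + (1 - p) * c false = 0 ->
  \sum_(f : {ffun 'I_n -> bool} | n%:R * e <= \sum_i c (f i))
     \prod_i bernoulli_weight p (f i) <= expR (- (n%:R * e ^+ 2 / 8)).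
Proof.
move=> p01 /andP[e0 e1] c1 c0; pose t := e / 4.
have w0 b : 0 <= bernoulli_weight p b.
  by case: b; rewrite /bernoulli_weight; case/andP: p01 => ? ?; lra.
have t0 : 0 <= t by rewrite /t; lra.
apply: (@le_trans _ _ (\sum_(f : {ffun 'I_n -> bool})
    \prod_i (bernoulli_weight p (f i) * expR (t * c (f i))) * expR (- (t * (n%:R * e))))).
  rewrite [leRHS](bigID (fun f : {ffun 'I_n -> bool} => n%:R * e <= \sum_i c (f i)))/=.
  rewrite -[leLHS]addr0 lerD//; last first.
    apply: sumr_ge0 => f _; rewrite mulr_ge0 ?expR_ge0//.
    by apply: prodr_ge0 => i _; rewrite mulr_ge0 ?expR_ge0.
  apply: ler_sum => f hf; rewrite big_split/= -mulrA ler_peMr//.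
    exact: prodr_ge0.
  rewrite -expR_sum -expRD -mulr_sumr -mulrBr.
  by rewrite -{1}(@expR0 R) ler_expR mulr_ge0// subr_ge0.
rewrite -mulr_suml -(bigA_distr_bigA (fun=> fun b => bernoulli_weight p b * expR (t * c b)))/=.
rewrite prodr_const card_ord big_bool/=.
have h := @bernoulli_mgf_le p t c p01 _ c1 c0.
have {}h : p * expR (t * c true) + (1 - p) * expR (t * c false) <= expR (2 * t ^+ 2).
  by apply: h; rewrite ger0_norm// /t; lra.
apply: (@le_trans _ _ (expR (2 * t ^+ 2) ^+ n * expR (- (t * (n%:R * e))))).
  rewrite ler_pM2r ?expR_gt0// lerXn2r// nnegrE ?expR_ge0//.
  by case/andP: p01 => p0 p1; rewrite addr_ge0// mulr_ge0// ?expR_ge0//; lra.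
(* At [t = e / 4] the exponent [n * (2 * t ^+ 2 - t * e)] equals [- n * e ^+ 2 / 8]. *)
rewrite -expRM_natl -expRD ler_expR /t.
by rewrite le_eqVlt; apply/orP; left; apply/eqP; field.
Qed.

Lemma measure_bigsetU_le {d} {T : measurableType d} (mu : {measure set T -> \bar R})
   {I : Type} (r : seq I) (Q : pred I) (A : I -> set T) :
  (forall i, Q i -> measurable (A i)) ->
  (mu (\big[setU/set0]_(i <- r | Q i) A i) <= \sum_(i <- r | Q i) mu (A i))%E.
Proof.
move=> mA; elim: r => [|i r ih]; first by rewrite !big_nil measure0.
rewrite !big_cons; case: ifPn => // Qi.
apply: (le_trans (measureU2 _ _ _)); [exact: mA|exact: bigsetU_measurable|].
by rewrite leeD2l.
Qed.

(** * Frequency of an event along an independent sequence *)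

Section Sample.
Context {d} {Omega : measurableType d} {d'} {T : measurableType d'}
  (P : probability Omega R) (X : nat -> Omega -> T).
Hypothesis mX : forall i, measurable_fun setT (X i).
Hypothesis indep : forall n (B : nat -> set T), (forall i, measurable (B i)) ->
  P (\bigcap_(i in `I_n) (X i @^-1` B i)) = (\prod_(i < n) P (X i @^-1` B i))%E.

Let side (B : set T) (b : bool) : set T := if b then B else ~` B.

(** The sets are indexed by all of [nat], with [setT] from [n] on, because [indep] asks for a
    sequence of measurable sets. *)
Let pattern_event n (B : set T) (f : {ffun 'I_n -> bool}) : set Omega :=
  \bigcap_(i in `I_n) (X i @^-1` (if insub i is Some j then side B (f j) else setT)).

Lemma measurable_preimX B i : measurable B -> measurable (X i @^-1` B).
Proof. by move=> mB; rewrite -[_ @^-1` _]setTI; exact: mX. Qed.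

Lemma measurable_pattern_event n B f : measurable B -> measurable (@pattern_event n B f).
Proof.
move=> mB; apply: fin_bigcap_measurable => [|i _]; first exact: finite_II.
apply: measurable_preimX; case: insubP => // j _ _; rewrite /side.
by case: (f j) => //; exact: measurableC.
Qed.

Lemma prob_pattern_event n B f p : measurable B ->
  (forall i, P (X i @^-1` B) = p%:E) ->
  P (@pattern_event n B f) = (\prod_i bernoulli_weight p (f i))%:E.
Proof.
move=> mB PB; rewrite /pattern_event indep; last first.
  move=> i; case: insubP => // j _ _; rewrite /side.
  by case: (f j) => //; exact: measurableC.
rewrite -prodEFin; apply: eq_bigr => i _.
rewrite (valK i).
rewrite /side /bernoulli_weight; case: (f i) => //.
rewrite preimage_setC probability_setC; last exact: measurable_preimX.
by rewrite PB EFinB.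
Qed.

(** Each Boolean pattern of hits and misses has an explicit product probability, so both tails are
    finite unions of pattern events bounded by [bernoulli_chernoff]; the two tails give the factor
    [2]. *)
Lemma frequency_deviation n B p e : measurable B ->
  (forall i, P (X i @^-1` B) = p%:E) -> 0 <= e <= 1 ->
  exists F : set Omega, [/\ measurable F,
    [set w | n%:R * e <= `|\sum_(i < n) (X i w \in B)%:R - n%:R * p| ] `<=` F &
    (P F <= (2 * expR (- (n%:R * e ^+ 2 / 8)))%:E)%E].
Proof.
move=> mB PB e01.
have p01 : 0 <= p <= 1.
  rewrite -!lee_fin -(PB 0%N) measure_ge0/= probability_le1//.
  exact: measurable_preimX.
pose cu b : R := b%:R - p; pose cl b : R := p - b%:R.
pose G (c : bool -> R) := \big[setU/set0]_(f : {ffun 'I_n -> bool} |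
   n%:R * e <= \sum_i c (f i)) @pattern_event n B f.
have mG c : measurable (G c).
  by apply: bigsetU_measurable => f _; exact: measurable_pattern_event.
have PG c : (forall b, `|c b| <= 1) -> p * c true + (1 - p) * c false = 0 ->
    (P (G c) <= (expR (- (n%:R * e ^+ 2 / 8)))%:E)%E.
  move=> c1 c0; apply: (le_trans (measure_bigsetU_le _ _ _ _ _)).
    by move=> f _; exact: measurable_pattern_event.
  rewrite (eq_bigr _ (fun f _ => prob_pattern_event n B f p mB PB)).
  by rewrite sumEFin lee_fin; exact: bernoulli_chernoff.
have Gin w (c : bool -> R) : n%:R * e <= \sum_(i < n) c (X i w \in B) -> G c w.
  move=> h; rewrite /G -bigcup_seq_cond.
  exists [ffun i : 'I_n => X i w \in B].
    rewrite /= mem_index_enum/=; under eq_bigr do rewrite ffunE; exact: h.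
  move=> i /= iin; rewrite /preimage/=; rewrite insubT/= ffunE/= /side.
  by case: ifPn => [|/negP]; rewrite inE.
exists (G cu `|` G cl); split.
- exact: measurableU.
- move=> w /=; rewrite ler_normr => /orP[h|h]; [left|right]; apply: Gin.
  + by apply: (le_trans h); rewrite sumrB sumr_const card_ord mulr_natl.
  + by apply: (le_trans h); rewrite sumrB sumr_const card_ord mulr_natl opprB.
- apply: (le_trans (measureU2 _ _ _)); [exact: mG|exact: mG|].
  rewrite mulr_natl mulr2n EFinD; apply: leeD; apply: PG => //.
  + by case; rewrite /cu ler_norml; case/andP: p01 => ? ?; apply/andP; split=> /=; lra.
  + by rewrite /cu/=; ring.
  + by case; rewrite /cl ler_norml; case/andP: p01 => ? ?; apply/andP; split=> /=; lra.
  + by rewrite /cl/=; ring.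
Qed.

End Sample.
End Concentration.

(** * Almost sure rate on the grid of mesh [1/n] *)

Section UniformRate.
Context {R : realType}.

(** With [k > 4 / a], raising [y / (8 k) <= expR (y / (8 k))] to the power [k] at [y = x ^ a] yields
    a multiple of [x ^ 4] for [x >= 1]. The fourth power leaves a summable bound after a union over
    about [n ^ 2] grid points. *)
Lemma expRN_powR_le (a : R) : 0 < a -> exists K : R, 0 <= K /\
  forall n, expR (- ((n.+1)%:R `^ a / 8)) <= K * (n.+1)%:R ^- 4.
Proof.
move=> a0; pose k := (Num.truncn (4 / a)).+1.
have ak : 4 <= a * k%:R.
  by rewrite -ler_pdivrMl// mulrC ltW// truncnS_gt.
have k0 : (0 : R) < k%:R by rewrite ltr0n.
exists ((8 * k%:R) ^+ k); split; first by rewrite exprn_ge0// mulr_ge0.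
move=> n; set x : R := (n.+1)%:R; set y := x `^ a.
have x1 : 1 <= x by rewrite /x ler1n.
have x0 : 0 < x by apply: lt_le_trans x1.
have y0 : 0 < y by exact: powR_gt0.
have h : (y / 8 / k%:R) ^+ k <= expR (y / 8).
  rewrite -[in leRHS](@divfK _ k%:R _ (y / 8)) ?gt_eqF// expRM_natr.
  rewrite lerXn2r ?nnegrE ?expR_ge0 ?divr_ge0 ?(ltW y0)//.
  by apply: le_trans (expR_ge1Dx _); rewrite lerDr.
have h4 : x ^+ 4 <= y ^+ k.
  rewrite /y -[leRHS]powR_mulrn ?powR_ge0// -powRrM -powR_mulrn ?(ltW x0)//.
  exact: ler_powR.
rewrite expRN ler_pdivlMr ?exprn_gt0// ler_pdivrMl ?expR_gt0//.
apply: (le_trans h4).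
have -> : y ^+ k = (y / 8 / k%:R) ^+ k * (8 * k%:R) ^+ k.
  by rewrite -exprMn; congr (_ ^+ _); field; rewrite gt_eqF.
by rewrite ler_wpM2r// exprn_ge0// mulr_ge0.
Qed.

Lemma nneseries_telescope_lt_pinfty (M : R) : 0 <= M ->
  (\sum_(n <oo) (M / ((n.+1)%:R * (n.+2)%:R))%:E < +oo)%E.
Proof.
move=> M0; apply: (@le_lt_trans _ _ M%:E); last exact: ltry.
apply: lime_le.
  by apply: is_cvg_nneseries => n _ _; rewrite lee_fin divr_ge0.
apply: nearW => n; rewrite sumEFin lee_fin.
rewrite (@telescope_sumr_eq _ 0%N n (fun k => - (M / k.+1%:R)))//; last first.
  move=> k _; rewrite [k.+2%:R]mulrSr.
  have ? : (k.+1%:R : R) != 0 by rewrite pnatr_eq0.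
  have ? : (k.+1%:R + 1 : R) != 0 by rewrite -mulrSr pnatr_eq0.
  by field; apply/andP.
by rewrite opprK divr1 gerDr oppr_le0 divr_ge0.
Qed.

Definition quadrant (u v : R) : set (R * R) := [set z | z.1 <= u /\ z.2 <= v].

Lemma measurable_quadrant u v : measurable (quadrant u v).
Proof.
rewrite (_ : quadrant u v = `]-oo, u] `*` `]-oo, v]); first exact: measurableX.
by apply/seteqP; split=> -[x y]/=; rewrite !in_itv.
Qed.

Definition emp_count (xs : nat -> R * R) n u v : R :=
  \sum_(k < n) (xs k \in quadrant u v)%:R.

Context {d} {Omega : measurableType d} (P : probability Omega R)
  (C : R -> R -> R) (X : nat -> Omega -> R * R).
Hypothesis iidX : iid_with_df P X C.

Let PX i u v : unitI u -> unitI v -> P (X i @^-1` quadrant u v) = (C u v)%:E.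
Proof. by case: iidX => _ [_ +]; exact. Qed.

(** Union bound over the grid, then Borel-Cantelli over the sample size. *)
Lemma ae_grid_deviation (r : R) : 0 < r < 2^-1 ->
  {ae P, forall w, \forall n \near \oo, forall i j, (i <= n)%N -> (j <= n)%N ->
     `|emp_count (X^~ w) n (i%:R / n%:R) (j%:R / n%:R)
        - n%:R * C (i%:R / n%:R) (j%:R / n%:R)| <= n%:R * n%:R `^ (- r)}.
Proof.
move=> /andP[r0 r12]; have [mX [indep _]] := iidX.
(* At deviation [m ^ (- r)] the Chernoff exponent [m * e ^+ 2 / 8] is [m ^ a / 8], and [r < 1/2]
   makes [a] positive. *)
pose a := 1 - 2 * r; have a0 : 0 < a by rewrite /a; lra.
have [K [K0 HK]] := expRN_powR_le _ a0.
(* The sample size is [m = n.+1], which avoids division by zero; the grid [0, ..., m] then has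
   [n.+2] points in each direction. *)
pose bad n (ij : 'I_n.+2 * 'I_n.+2) := let m := n.+1 in
  let u : R := ij.1%:R / m%:R in let v : R := ij.2%:R / m%:R in
  [set w | m%:R * m%:R `^ (- r) <= `|\sum_(k < m) (X k w \in quadrant u v)%:R - m%:R * C u v|].
have unitg n (i : 'I_n.+2) : unitI (i%:R / n.+1%:R : R).
  rewrite /unitI/= in_itv/= divr_ge0//= ler_pdivrMr ?ltr0n// mul1r ler_nat.
  by rewrite -ltnS ltn_ord.
have Hbad n ij : exists F, [/\ measurable F, bad n ij `<=` F &
    (P F <= (2 * K * n.+1%:R ^- 4)%:E)%E].
  have e01 : 0 <= (n.+1%:R : R) `^ (- r) <= 1.
    rewrite powR_ge0/= -[leRHS](@powRr0 _ n.+1%:R) ler_powR ?ler1n//; lra.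
  have [F [mF badF PF]] := frequency_deviation P X mX indep n.+1
    _ _ _ (measurable_quadrant (ij.1%:R / n.+1%:R) (ij.2%:R / n.+1%:R))
    (fun i => PX i _ _ (unitg _ _) (unitg _ _)) e01.
  exists F; split => //; apply: (le_trans PF); rewrite lee_fin -[leRHS]mulrA ler_pM2l//.
  apply: le_trans (HK n); rewrite ler_expR lerN2 ler_pM2r//.
  rewrite -powR_mulrn ?powR_ge0// -powRrM -[X in X * _](@powRr1 _ n.+1%:R)//.
  rewrite -powRD; last by rewrite pnatr_eq0 implybT.
  rewrite le_eqVlt; apply/orP; left; apply/eqP; congr powR; rewrite /a; ring.
have /choice [G HG] : forall n, exists G, [/\ measurable G,
    (forall ij, bad n ij `<=` G) &
    (P G <= ((48 * K) / ((n.+1)%:R * (n.+2)%:R))%:E)%E].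
  move=> n; have /choice[F HF] := Hbad n.
  exists (\big[setU/set0]_ij F ij); split.
  - by apply: bigsetU_measurable => ij _; have [] := HF ij.
  - move=> ij w hw; rewrite -bigcup_seq; exists ij => /=; first exact: mem_index_enum.
    by have [_ + _] := HF ij; exact.
  - have mF : forall ij, true -> measurable (F ij) by move=> ij _; have [] := HF ij.
    apply: (le_trans (measure_bigsetU_le P _ _ _ mF)).
    apply: (@le_trans _ _ (\sum_(ij : 'I_n.+2 * 'I_n.+2) (2 * K * n.+1%:R ^- 4)%:E)%E).
      by apply: lee_sum => ij _; have [] := HF ij.
    rewrite sumEFin lee_fin sumr_const card_prod card_ord -[leLHS]mulr_natl natrM.
    rewrite [n.+2%:R]mulrSr; set x : R := n.+1%:R.
    have x1 : 1 <= x by rewrite /x ler1n.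
    have x0 : 0 < x by apply: lt_le_trans x1.
    rewrite ler_pdivlMr; last by rewrite mulr_gt0//; lra.
    have -> : (x + 1) * (x + 1) * (2 * K * x ^- 4) * (x * (x + 1))
        = 2 * K * ((x + 1) ^+ 3 / x ^+ 3) by field; rewrite gt_eqF.
    (* The claim reduces to [(x + 1) ^+ 3 <= 24 * x ^+ 3], which holds with room to spare as
       [x + 1 <= 2 * x]. *)
    rewrite (_ : 48 * K = 2 * K * 24); last by ring.
    rewrite ler_wpM2l ?mulr_ge0// ler_pdivrMr ?exprn_gt0//; nra.
have P0 : P (lim_sup_set G) = 0.
  apply: lim_sup_set_cvg0; first by move=> n; have [] := HG n.
  apply: le_lt_trans (nneseries_telescope_lt_pinfty (48 * K) _); last by rewrite mulr_ge0.
  apply: lee_nneseries => [n _ _|n _]; first exact: measure_ge0.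
  by have [] := HG n.
have mG : measurable (lim_sup_set G).
  apply: bigcap_measurable => // k _; apply: bigcup_measurable => j _.
  by have [] := HG j.
exists (lim_sup_set G); split => // w; apply: contra_notP => /=.
rewrite /lim_sup_set => /existsNP[N] /not_implyP[_ hN].
(* [G n] concerns the sample size [n.+1], hence the shifted threshold. *)
exists N.+1 => //= -[//|n] Nn i j ilen jlen; rewrite leNgt; apply/negP => /ltW h.
apply: hN; exists n => //; have [_ + _] := HG n.
move=> /(_ (Ordinal (ilen : (i < n.+2)%N), Ordinal (jlen : (j < n.+2)%N))); apply.
exact: h.
Qed.

End UniformRate.

(** * Copulas and empirical copulas *)

Section CopulaFunction.
Context {R : realType}.
Implicit Types (u v : R) (C : R -> R -> R).

(** The analytic form of a copula. The last clause says that rectangles have nonnegative volume,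
    written as growth of a vertical strip's volume with its height. *)
Definition grounded_2increasing C :=
  [/\ forall u, unitI u -> C u 0 = 0, forall v, unitI v -> C 0 v = 0,
      forall u, unitI u -> C u 1 = u, forall v, unitI v -> C 1 v = v &
      forall u u' v v', unitI u -> unitI u' -> unitI v -> unitI v' ->
        u <= u' -> v <= v' -> C u' v - C u v <= C u' v' - C u v'].

Lemma unitIE u : unitI u = (0 <= u <= 1) :> Prop.
Proof. by rewrite /unitI/= in_itv. Qed.

Lemma unitI0 : unitI (0 : R). Proof. by rewrite unitIE lexx ler01. Qed.
Lemma unitI1 : unitI (1 : R). Proof. by rewrite unitIE lexx ler01. Qed.

Lemma measurable_unitI : measurable (@unitI R).
Proof. exact: measurable_itv. Qed.

Lemma measureXUl (mu : probability (R * R)%type R) (A A' B : set R) :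
  measurable A -> measurable A' -> measurable B -> A `&` A' = set0 ->
  mu ((A `|` A') `*` B) = (mu (A `*` B) + mu (A' `*` B))%E.
Proof.
move=> mA mA' mB AA'.
have -> : (A `|` A') `*` B = A `*` B `|` A' `*` B.
  by apply/seteqP; split=> -[x y] /=; tauto.
rewrite measureU//; [exact: measurableX|exact: measurableX|].
by rewrite -setXI AA' set0X.
Qed.

Lemma measureXUr (mu : probability (R * R)%type R) (A B B' : set R) :
  measurable A -> measurable B -> measurable B' -> B `&` B' = set0 ->
  mu (A `*` (B `|` B')) = (mu (A `*` B) + mu (A `*` B'))%E.
Proof.
move=> mA mB mB' BB'.
have -> : A `*` (B `|` B') = A `*` B `|` A `*` B'.
  by apply/seteqP; split=> -[x y] /=; tauto.
rewrite measureU//; [exact: measurableX|exact: measurableX|].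
by rewrite -setXI BB' setX0.
Qed.

Lemma measureX_le (mu : probability (R * R)%type R) (A A' B B' : set R) :
  measurable A -> measurable A' -> measurable B -> measurable B' ->
  A `<=` A' -> B `<=` B' -> (mu (A `*` B) <= mu (A' `*` B'))%E.
Proof.
move=> mA mA' mB mB' AA' BB'; apply: le_measure; rewrite ?inE; try exact: measurableX.
by move=> [x y] /= [/AA' ? /BB' ?].
Qed.

(** The boundary values come from the uniform marginals, and [C u' w - C u w] is the mass of []u,
    u'] x [0, w]], which increases with [w]. *)
Lemma is_copula_grounded C : is_copula C -> grounded_2increasing C.
Proof.
move=> [mu [[mu1 muC] muB]].
have muB1 B : measurable B -> mu (B `*` setT) = lebesgue_measure (B `&` @unitI R).
  by move=> /muB[].
have muB2 B : measurable B -> mu (setT `*` B) = lebesgue_measure (B `&` @unitI R).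
  by move=> /muB[].
have mI := measurable_unitI; have mIc := measurableC mI.
have mi (a b : R) : measurable `[a, b]%classic by exact: measurable_itv.
have l0 : lebesgue_measure (`[0, 0]%classic `&` @unitI R) = 0%E.
  apply/eqP; rewrite eq_le measure_ge0 andbT -(lebesgue_measure_set1 (0 : R)).
  by apply: le_measure; rewrite ?inE ?set_itv1//; exact: measurableI.
have lc : lebesgue_measure (~` @unitI R `&` @unitI R) = 0%E.
  by rewrite setICl measure0.
have lu u : unitI u -> lebesgue_measure (`[0, u]%classic `&` @unitI R) = u%:E.
  rewrite unitIE => /andP[u0 u1]; rewrite setIidl; last first.
    move=> x/=; rewrite unitIE in_itv/= => /andP[-> /le_trans]; exact.
  rewrite lebesgue_measure_itv/= lte_fin.
  by case: ltgtP u0 => // [_|<-] _; rewrite ?sube0.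
(* The complement of [[0, 1]] is null for both marginals, so [setT] may replace [[0, 1]] in either
   factor. *)
have TE : setT = `[0, 1]%classic `|` ~` @unitI R by rewrite setUv.
split.
- move=> u hu; apply/EFin_inj; rewrite -muC//; last exact: unitI0.
  by apply/eqP; rewrite eq_le measure_ge0 andbT -[leRHS]l0 -muB2//; exact: measureX_le.
- move=> v hv; apply/EFin_inj; rewrite -muC//; last exact: unitI0.
  by apply/eqP; rewrite eq_le measure_ge0 andbT -[leRHS]l0 -muB1//; exact: measureX_le.
- move=> u hu; apply/EFin_inj; rewrite -muC//; last exact: unitI1.
  rewrite -(lu u hu) -muB1// [in RHS]TE measureXUr//; last by rewrite setICr.
  rewrite [X in (_ = _ + X)%E](_ : _ = 0%E) ?adde0//.
  by apply/eqP; rewrite eq_le measure_ge0 andbT -lc -muB2//; exact: measureX_le.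
- move=> v hv; apply/EFin_inj; rewrite -muC//; last exact: unitI1.
  rewrite -(lu v hv) -muB2// [in RHS]TE measureXUl//; last by rewrite setICr.
  rewrite [X in (_ = _ + X)%E](_ : _ = 0%E) ?adde0//.
  by apply/eqP; rewrite eq_le measure_ge0 andbT -lc -muB1//; exact: measureX_le.
- move=> u u' v v' hu hu' hv hv' uu' vv'.
  have /andP[u0 _] : 0 <= u <= 1 by rewrite -unitIE.
  have mi' : measurable (`]u, u']%classic : set R) by exact: measurable_itv.
  have H w : unitI w -> (C u' w)%:E = ((C u w)%:E + mu (`]u, u'] `*` `[0%R, w]))%E.
    move=> hw; rewrite -!muC//.
    rewrite (_ : `[0, u']%classic = `[0, u]%classic `|` `]u, u']%classic); last first.
      by rewrite -itv_bndbnd_setU// bnd_simp.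
    rewrite measureXUl//; apply/seteqP; split => // x/=.
    by rewrite !in_itv/= => -[/andP[_ xu] /andP[]]; rewrite ltNge xu.
  have D w : unitI w -> (C u' w - C u w)%:E = mu (`]u, u'] `*` `[0%R, w]).
    by move=> hw; rewrite EFinB H// addeAC subee// add0e.
  rewrite -lee_fin !D//; apply: measureX_le => //.
  by move=> x/=; rewrite !in_itv/= => /andP[-> /le_trans]; exact.
Qed.

Section Properties.
Variable C : R -> R -> R.
Hypothesis gC : grounded_2increasing C.

Let in_u {u} : unitI u -> 0 <= u <= 1. Proof. by rewrite unitIE. Qed.

(** The increment at height [v] lies between those at heights [0] and [1], which are [0] and
    [u' - u]. *)
Lemma copula_incr1 u u' v : unitI u -> unitI u' -> unitI v -> u <= u' ->
  0 <= C u' v - C u v <= u' - u.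
Proof.
case: gC => C0r C0l C1r _ inc hu hu' hv uu'; have /andP[v0 v1] := in_u hv.
have := inc _ _ _ _ hu hu' unitI0 hv uu' v0; rewrite !C0r// subrr => ->/=.
by have := inc _ _ _ _ hu hu' hv unitI1 uu' v1; rewrite !C1r.
Qed.

Lemma copula_incr2 u v v' : unitI u -> unitI v -> unitI v' -> v <= v' ->
  0 <= C u v' - C u v <= v' - v.
Proof.
case: gC => C0r C0l _ C1l inc hu hv hv' vv'; have /andP[u0 u1] := in_u hu.
have := inc _ _ _ _ unitI0 hu hv hv' u0 vv'.
have := inc _ _ _ _ hu unitI1 hv hv' u1 vv'.
rewrite !C0l// !C1l//; lra.
Qed.

Lemma copula_lipschitz u u' v v' : unitI u -> unitI u' -> unitI v -> unitI v' ->
  `|C u v - C u' v'| <= `|u - u'| + `|v - v'|.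
Proof.
move=> hu hu' hv hv'.
have -> : C u v - C u' v' = (C u v - C u' v) + (C u' v - C u' v') by ring.
apply: (le_trans (ler_normD _ _)); apply: lerD.
- have [uu'|/ltW uu'] := leP u u'.
    by rewrite distrC [leRHS]distrC !ger0_norm ?subr_ge0//;
      have /andP[] := copula_incr1 _ _ _ hu hu' hv uu'; rewrite ?subr_ge0.
  by rewrite !ger0_norm ?subr_ge0//;
      have /andP[] := copula_incr1 _ _ _ hu' hu hv uu'; rewrite ?subr_ge0.
- have [vv'|/ltW vv'] := leP v v'.
    by rewrite distrC [leRHS]distrC !ger0_norm ?subr_ge0//;
      have /andP[] := copula_incr2 _ _ _ hu' hv hv' vv'; rewrite ?subr_ge0.
  by rewrite !ger0_norm ?subr_ge0//;
      have /andP[] := copula_incr2 _ _ _ hu' hv' hv vv'; rewrite ?subr_ge0.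
Qed.

Lemma copula_le_min u v : unitI u -> unitI v -> 0 <= C u v /\ C u v <= u /\ C u v <= v.
Proof.
move=> hu hv; have /andP[v0 v1] := in_u hv; have /andP[u0 u1] := in_u hu.
case: gC => C0r C0l _ _ _.
have := copula_incr1 _ _ _ unitI0 hu hv u0; have := copula_incr2 _ _ _ hu unitI0 hv v0.
rewrite C0r// C0l//; lra.
Qed.

End Properties.
End CopulaFunction.

(** * Distance from the empirical copula to [C] *)

Section EmpiricalCopula.
Context {R : realType}.
Implicit Types (xs : nat -> R * R) (C : R -> R -> R).

Lemma card_ord_mkset n (Q : pred 'I_n) :
  (#|[set k : 'I_n | Q k]%classic|%:R : R) = \sum_(k < n) (Q k)%:R.
Proof.
rewrite -natr_sum -sum1_card big_mkcond/=; congr (_%:R); apply: eq_bigr => k _.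
rewrite (_ : (k \in _) = Q k); first by case: (Q k).
by apply/idP/idP; rewrite in_setE.
Qed.

Lemma in_quadrant (z : R * R) u v : (z \in quadrant u v) = (z.1 <= u) && (z.2 <= v).
Proof. by apply/idP/idP; rewrite in_setE => /andP. Qed.

Lemma emp_count_mono xs n u u' v v' : u <= u' -> v <= v' ->
  emp_count xs n u v <= emp_count xs n u' v'.
Proof.
move=> uu' vv'; apply: ler_sum => k _; rewrite !in_quadrant ler_nat.
have [/andP[h1 h2]|//] := boolP (_ && _).
by rewrite (le_trans h1 uu') (le_trans h2 vv').
Qed.

Lemma cellP n (u : R) : (0 < n)%N -> unitI u ->
  [/\ (cell n u < n)%N, (cell n u)%:R / n%:R <= u, u <= (cell n u).+1%:R / n%:R &
      0 <= Defs.frac n u <= 1].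
Proof.
move=> n0; rewrite unitIE => /andP[u0 u1].
have nr : (0 : R) < n%:R by rewrite ltr0n.
have nu : 0 <= n%:R * u by rewrite mulr_ge0.
have c1 : (cell n u)%:R <= n%:R * u.
  by rewrite (@le_trans _ _ (Num.truncn (n%:R * u))%:R) ?truncn_le// ler_nat geq_minl.
have c2 : n%:R * u <= (cell n u).+1%:R.
  rewrite /cell; case: (leqP (Num.truncn (n%:R * u)) n.-1) => h.
    by rewrite ltW// truncnS_gt.
  by rewrite prednK// ler_piMr.
split.
- by rewrite -[ltnRHS]prednK// ltnS geq_minr.
- by rewrite ler_pdivrMr// mulrC.
- by rewrite ler_pdivlMr// mulrC.
- by rewrite /Defs.frac subr_ge0 c1/= lerBlDr -mulrS.
Qed.

(** The count is monotone in both arguments, hence squeezed between its values at two opposite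
    corners of the cell, and between these corners and [(u, v)] the copula changes by at most
    [2 / n]. *)
Lemma emp_count_deviation xs C n (e : R) : grounded_2increasing C -> (0 < n)%N ->
  (forall i j, (i <= n)%N -> (j <= n)%N ->
     `|emp_count xs n (i%:R / n%:R) (j%:R / n%:R)
        - n%:R * C (i%:R / n%:R) (j%:R / n%:R)| <= n%:R * e) ->
  forall u v, unitI u -> unitI v ->
    `|emp_count xs n u v / n%:R - C u v| <= e + 2 / n%:R.
Proof.
move=> gC n0 H u v hu hv.
have nr : (0 : R) < n%:R by rewrite ltr0n.
have {}H i j : (i <= n)%N -> (j <= n)%N ->
    `|emp_count xs n (i%:R / n%:R) (j%:R / n%:R) / n%:R - C (i%:R / n%:R) (j%:R / n%:R)| <= e.
  move=> hi hj; rewrite -(ler_pM2l nr); apply: le_trans (H i j hi hj).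
  rewrite -{1}(gtr0_norm nr) -normrM mulrBr mulrCA divff ?gt_eqF// mulr1.
  exact: lexx.
have ug i : (i <= n)%N -> unitI (i%:R / n%:R : R).
  by move=> h; rewrite unitIE divr_ge0//= ler_pdivrMr// mul1r ler_nat.
have [i1 iu ui _] := cellP _ _ n0 hu; have [j1 jv vj _] := cellP _ _ n0 hv.
have S1 m : m.+1%:R / n%:R = m%:R / n%:R + n%:R^-1 :> R by rewrite mulrSr mulrDl mul1r.
have Lu w : w.+1%:R / n%:R - w%:R / n%:R = n%:R^-1 :> R by rewrite S1; ring.
set i := cell n u in i1 iu ui *; set j := cell n v in j1 jv vj *.
have lo : emp_count xs n (i%:R / n%:R) (j%:R / n%:R) / n%:R <= emp_count xs n u v / n%:R.
  by rewrite ler_pM2r ?invr_gt0//; exact: emp_count_mono.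
have hi : emp_count xs n u v / n%:R <= emp_count xs n (i.+1%:R / n%:R) (j.+1%:R / n%:R) / n%:R.
  by rewrite ler_pM2r ?invr_gt0//; exact: emp_count_mono.
have Hl := H i j (ltnW i1) (ltnW j1); have Hh := H i.+1 j.+1 i1 j1.
have Cl := copula_lipschitz _ gC _ _ _ _ hu (ug _ (ltnW i1)) hv (ug _ (ltnW j1)).
have Ch := copula_lipschitz _ gC _ _ _ _ (ug _ i1) hu (ug _ j1) hv.
have [ui1 vj1] := (S1 i, S1 j).
move: Cl Ch; rewrite (ger0_norm (_ : 0 <= u - _)) ?subr_ge0// (ger0_norm (_ : 0 <= v - _)) ?subr_ge0//.
rewrite (ger0_norm (_ : 0 <= _ - u)) ?subr_ge0// (ger0_norm (_ : 0 <= _ - v)) ?subr_ge0//.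
move: Hl Hh; rewrite !ler_norml => /andP[? ?] /andP[? ?] /andP[? ?] /andP[? ?].
apply/andP; lra.
Qed.

Lemma card_rankE (xs : nat -> R * R) n (k : nat) (p : R * R -> R) :
  \sum_(l < n) (p (xs l) <= p (xs k))%R%:R = #|[set l : 'I_n | (p (xs l) <= p (xs k))%R]%classic|%:R :> R.
Proof. by rewrite card_ord_mkset. Qed.

(* Ties are harmless: up to [e], being of rank at most [i] is squeezed between lying below
   [i/n - e] and lying below [i/n + e]. *)
Lemma emp_subcopula_dist xs C n (e : R) : grounded_2increasing C -> (0 < n)%N ->
  (forall k, (xs k).1 <= 1 /\ (xs k).2 <= 1) ->
  (forall u v, unitI u -> unitI v -> `|emp_count xs n u v / n%:R - C u v| < e) ->
  forall i j, (i <= n)%N -> (j <= n)%N ->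
    `|emp_subcopula xs n i j - C (i%:R / n%:R) (j%:R / n%:R)| <= 3 * e.
Proof.
move=> gC n0 xs1 H i j iN jN.
have nr : (0 : R) < n%:R by rewrite ltr0n.
have e0 : 0 < e by apply: le_lt_trans (H 0 0 unitI0 unitI0).
have ug m : (m <= n)%N -> unitI (m%:R / n%:R : R).
  by move=> h; rewrite unitIE divr_ge0//= ler_pdivrMr// mul1r ler_nat.
have hi := ug _ iN; have hj := ug _ jN.
have [_ _ C1r C1l _] := gC.
have ES : emp_subcopula xs n i j =
    (\sum_(k < n) ((rank1 xs n k <= i)%N && (rank2 xs n k <= j)%N)%:R) / n%:R.
  by rewrite /emp_subcopula card_ord_mkset.
(* Since the sample is bounded above by [1], a marginal count is a quadrant count with the other
   coordinate set to [1]; thus [H] also controls the ranks. *)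
pose low (p : R * R -> R) (u : R) : R := \sum_(l < n) (p (xs l) <= u)%R%:R.
have low1 u : low fst u = emp_count xs n u 1.
  apply: eq_bigr => l _; rewrite in_quadrant.
  by have [_ ->] := xs1 l; rewrite andbT.
have low2 v : low snd v = emp_count xs n 1 v.
  apply: eq_bigr => l _; rewrite in_quadrant.
  by have [-> _] := xs1 l.
have low1E u : unitI u -> `|low fst u - n%:R * u| < n%:R * e.
  move=> hu; have := H u 1 hu unitI1; rewrite -low1 C1r// -(ltr_pM2l nr).
  by rewrite -{1}(gtr0_norm nr) -normrM mulrBr mulrC divfK ?gt_eqF.
have low2E v : unitI v -> `|low snd v - n%:R * v| < n%:R * e.
  move=> hv; have := H 1 v unitI1 hv; rewrite -low2 C1l// -(ltr_pM2l nr).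
  by rewrite -{1}(gtr0_norm nr) -normrM mulrBr mulrC divfK ?gt_eqF.
have lowM (p : R * R -> R) u u' : u <= u' -> low p u <= low p u'.
  move=> uu'; apply: ler_sum => l _; rewrite ler_nat.
  by have [h|//] := boolP (_ <= u); rewrite (le_trans h uu').
have down (p : R * R -> R) k u m : p (xs k) <= u -> low p u <= m%:R ->
    (#|[set l : 'I_n | (p (xs l) <= p (xs k))%R]%classic| <= m)%N.
  move=> /(lowM p) h1 h2; rewrite -(ler_nat R) -(card_rankE xs n k p).
  exact: le_trans h1 h2.
have up (p : R * R -> R) k u m : m%:R < low p u ->
    (#|[set l : 'I_n | (p (xs l) <= p (xs k))%R]%classic| <= m)%N -> p (xs k) <= u.
  move=> h1; rewrite -(ler_nat R) -(card_rankE xs n k p) => h2; rewrite leNgt.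
  apply/negP => /ltW/(lowM p) h3.
  by have := lt_le_trans h1 (le_trans h3 h2); rewrite ltxx.
have divn_e m w : n%:R * (m%:R / n%:R + w) = m%:R + n%:R * w :> R.
  by rewrite mulrDr mulrCA divff ?gt_eqF// mulr1.
have hi' : 0 <= (i%:R / n%:R : R) <= 1 by rewrite -unitIE.
have hj' : 0 <= (j%:R / n%:R : R) <= 1 by rewrite -unitIE.
rewrite ler_norml; apply/andP; split.
- have [Cp [Ci Cj]] := copula_le_min _ gC _ _ hi hj.
  have emp0 : 0 <= emp_subcopula xs n i j by rewrite ES divr_ge0// sumr_ge0.
  (* If [i/n] or [j/n] is below [e], then so is [C] there, and nonnegativity of the empirical value
     suffices. Otherwise both levels can be lowered by [e] inside [[0, 1]]. *)
  have [hie|hie] := ltP (i%:R / n%:R) e; first by lra.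
  have [hje|hje] := ltP (j%:R / n%:R) e; first by lra.
  have hu : unitI (i%:R / n%:R - e) by rewrite unitIE; apply/andP; lra.
  have hv : unitI (j%:R / n%:R - e) by rewrite unitIE; apply/andP; lra.
  have cnt : emp_count xs n (i%:R / n%:R - e) (j%:R / n%:R - e) / n%:R <= emp_subcopula xs n i j.
    rewrite ES ler_pM2r ?invr_gt0//; apply: ler_sum => k _; rewrite in_quadrant ler_nat.
    have [/andP[h1 h2]|//] := boolP (_ && _).
    have -> : (rank1 xs n k <= i)%N.
      apply: (down fst _ _ _ h1); have := low1E _ hu.
      rewrite divn_e mulrN ltr_norml => /andP[]; lra.
    have -> // : (rank2 xs n k <= j)%N.
      apply: (down snd _ _ _ h2); have := low2E _ hv.
      rewrite divn_e mulrN ltr_norml => /andP[]; lra.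
  have := H _ _ hu hv; have := copula_lipschitz _ gC _ _ _ _ hi hu hj hv.
  rewrite !opprB !(addrC _ (e - _)) !subrK (gtr0_norm e0).
  rewrite ler_norml ltr_norml => /andP[? ?] /andP[? ?]; lra.
(* The raised levels are cut at [1] to remain in the domain of [H]. Where the cut is active, the
   required bound on the sample point is [xs1]. *)
- pose u : R := Num.min 1 (i%:R / n%:R + e); pose v : R := Num.min 1 (j%:R / n%:R + e).
  have u1 : i%:R / n%:R <= u <= i%:R / n%:R + e.
    by rewrite /u le_min ge_min lexx orbT; apply/andP; split=> //; apply/andP; lra.
  have v1 : j%:R / n%:R <= v <= j%:R / n%:R + e.
    by rewrite /v le_min ge_min lexx orbT; apply/andP; split=> //; apply/andP; lra.
  have hu : unitI u by rewrite unitIE ge_min lexx/= andbT; lra.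
  have hv : unitI v by rewrite unitIE ge_min lexx/= andbT; lra.
  have cnt : emp_subcopula xs n i j <= emp_count xs n u v / n%:R.
    rewrite ES ler_pM2r ?invr_gt0//; apply: ler_sum => k _; rewrite in_quadrant ler_nat.
    have [/andP[h1 h2]|//] := boolP (_ && _).
    have -> : (xs k).1 <= u.
      have [hie|hie] := leP 1 (i%:R / n%:R + e).
        by rewrite /u (min_l hie); have [] := xs1 k.
      have uE : u = i%:R / n%:R + e by rewrite /u (min_r (ltW hie)).
      apply: (up fst _ _ _ _ h1); have := low1E _ hu.
      rewrite [in n%:R * u]uE divn_e ltr_norml => /andP[]; lra.
    have -> // : (xs k).2 <= v.
      have [hje|hje] := leP 1 (j%:R / n%:R + e).
        by rewrite /v (min_l hje); have [] := xs1 k.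
      have vE : v = j%:R / n%:R + e by rewrite /v (min_r (ltW hje)).
      apply: (up snd _ _ _ _ h2); have := low2E _ hv.
      rewrite [in n%:R * v]vE divn_e ltr_norml => /andP[]; lra.
  have := H _ _ hu hv; have := copula_lipschitz _ gC _ _ _ _ hu hi hv hj.
  case/andP: u1 => ? ?; case/andP: v1 => ? ?.
  rewrite (ger0_norm (_ : 0 <= u - _)) ?subr_ge0// (ger0_norm (_ : 0 <= v - _)) ?subr_ge0//.
  rewrite ler_norml ltr_norml => /andP[? ?] /andP[? ?]; lra.
Qed.

(** Bilinear interpolation is a convex combination of the four corner values; each is within [3 * e]
    of [C] at its corner, which is within [2 / n] of [C u v]. *)
Lemma emp_copula_dist xs C n (e : R) : grounded_2increasing C -> (0 < n)%N ->
  (forall k, (xs k).1 <= 1 /\ (xs k).2 <= 1) ->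
  (forall u v, unitI u -> unitI v -> `|emp_count xs n u v / n%:R - C u v| < e) ->
  forall u v, unitI u -> unitI v ->
    `|emp_copula xs n u v - C u v| <= 3 * e + 2 / n%:R.
Proof.
move=> gC n0 xs1 H u v hu hv.
have [i1 iu ui /andP[a0 a1]] := cellP _ _ n0 hu.
have [j1 jv vj /andP[b0 b1]] := cellP _ _ n0 hv.
have nr : (0 : R) < n%:R by rewrite ltr0n.
have ug m : (m <= n)%N -> unitI (m%:R / n%:R : R).
  by move=> h; rewrite unitIE divr_ge0//= ler_pdivrMr// mul1r ler_nat.
have S1 m : m.+1%:R / n%:R = m%:R / n%:R + n%:R^-1 :> R by rewrite mulrSr mulrDl mul1r.
rewrite /emp_copula.
set i := cell n u in i1 iu ui *; set j := cell n v in j1 jv vj *.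
set a := Defs.frac n u in a0 a1 *; set b := Defs.frac n v in b0 b1 *.
have corner i' j' : (i' <= n)%N -> (j' <= n)%N -> `|i'%:R / n%:R - u| <= n%:R^-1 ->
   `|j'%:R / n%:R - v| <= n%:R^-1 -> `|emp_subcopula xs n i' j' - C u v| <= 3 * e + 2 / n%:R.
  move=> hi' hj' hiu hjv.
  have h1 := emp_subcopula_dist _ _ _ _ gC n0 xs1 H _ _ hi' hj'.
  have h2 := copula_lipschitz _ gC _ _ _ _ (ug _ hi') hu (ug _ hj') hv.
  rewrite (_ : _ - C u v = (emp_subcopula xs n i' j' - C (i'%:R / n%:R) (j'%:R / n%:R))
    + (C (i'%:R / n%:R) (j'%:R / n%:R) - C u v)); last by ring.
  by apply: (le_trans (ler_normD _ _)); apply: lerD => //; lra.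
have [ui1 vj1] := (S1 i, S1 j).
have di : `|i%:R / n%:R - u| <= n%:R^-1 by rewrite distrC ger0_norm ?subr_ge0//; lra.
have di1 : `|i.+1%:R / n%:R - u| <= n%:R^-1 by rewrite ger0_norm ?subr_ge0//; lra.
have dj : `|j%:R / n%:R - v| <= n%:R^-1 by rewrite distrC ger0_norm ?subr_ge0//; lra.
have dj1 : `|j.+1%:R / n%:R - v| <= n%:R^-1 by rewrite ger0_norm ?subr_ge0//; lra.
have K1 := corner _ _ (ltnW i1) (ltnW j1) di dj.
have K2 := corner _ _ i1 (ltnW j1) di1 dj.
have K3 := corner _ _ (ltnW i1) j1 di dj1.
have K4 := corner _ _ i1 j1 di1 dj1.
set E := 3 * e + _ in K1 K2 K3 K4 *.
set e1 := emp_subcopula _ _ i j in K1 *; set e2 := emp_subcopula _ _ _ j in K2 *.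
set e3 := emp_subcopula _ _ i _ in K3 *; set e4 := emp_subcopula _ _ _ _ in K4 *.
have -> : (1 - a) * (1 - b) * e1 + a * (1 - b) * e2 + (1 - a) * b * e3 + a * b * e4 - C u v =
  (1 - a) * (1 - b) * (e1 - C u v) + a * (1 - b) * (e2 - C u v)
  + (1 - a) * b * (e3 - C u v) + a * b * (e4 - C u v) by ring.
have -> : E = (1 - a) * (1 - b) * E + a * (1 - b) * E + (1 - a) * b * E + a * b * E by ring.
clearbody a b.
have w1 : 0 <= (1 - a) * (1 - b) by rewrite mulr_ge0 ?subr_ge0.
have w2 : 0 <= a * (1 - b) by rewrite mulr_ge0 ?subr_ge0.
have w3 : 0 <= (1 - a) * b by rewrite mulr_ge0 ?subr_ge0.
have w4 : 0 <= a * b by rewrite mulr_ge0.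
have term w x : 0 <= w -> `|x| <= E -> `|w * x| <= w * E.
  by move=> w0 xE; rewrite normrM ger0_norm// ler_wpM2l.
do 3 ! (apply: (le_trans (ler_normD _ _)); apply: lerD; last exact: term).
exact: term.
Qed.

End EmpiricalCopula.

(** * Kernels as derivatives *)

Section KernelDerivative.
Context {R : realType}.
Implicit Types (G : R -> R) (x k : R).

Lemma lebesgue_unitI : lebesgue_measure (@unitI R) = 1%E.
Proof. by rewrite /unitI lebesgue_measure_itv/= lte_fin ltr01 sube0. Qed.

Lemma lebesgue_aeS (A B : R -> Prop) : (forall x, A x -> B x) ->
  (\forall x \ae (@lebesgue_measure R), A x) -> \forall x \ae (@lebesgue_measure R), B x.
Proof. by move=> AB; apply: filterS; first exact: (ae_filter_ringOfSetsType lebesgue_measure). Qed.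

(* Derivative along intervals containing [x] but not necessarily having it as an endpoint, as
   the grid cell around [x] does not. *)
Definition straddle_derive G x k := forall e, 0 < e -> exists2 d, 0 < d &
  forall a b, 0 <= a -> a <= x -> x <= b -> b <= 1 -> b - a < d ->
    `|G b - G a - k * (b - a)| <= e * (b - a).

(** Splitting the interval at [x], the Caratheodory slopes at both ends are within [e] of [k], and
    the two errors add up to [e * (b - a)]. Two functions appear because a copula is specified only
    on the unit square. *)
Lemma is_derive_straddle G H x k : (forall a, unitI a -> G a = H a) -> unitI x ->
  is_derive x 1 H k -> straddle_derive G x k.
Proof.
move=> GH xI /is_derive1_caratheodory[g [Hg cg gk]] e e0.
have := cg; rewrite /prop_for /continuous_at gk => /cvgrPdist_le/(_ _ e0).
move=> /nbhs_ballP[d /= d0 hd]; exists d => // a b a0 ax xb b1 bad.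
move: xI; rewrite unitIE => /andP[x0 x1].
have aI : unitI a by rewrite unitIE a0 (le_trans ax x1).
have bI : unitI b by rewrite unitIE b1 (le_trans x0 xb).
have ga : `|k - g a| <= e.
  by apply: hd; rewrite /ball/= ger0_norm ?subr_ge0//; apply: le_lt_trans bad; lra.
have gb : `|k - g b| <= e.
  by apply: hd; rewrite /ball/= distrC ger0_norm ?subr_ge0//; apply: le_lt_trans bad; lra.
rewrite !GH//.
have -> : H b - H a - k * (b - a) = - (k - g b) * (b - x) - (k - g a) * (x - a).
  rewrite (_ : H b - H a = (H b - H x) - (H a - H x)); last by ring.
  by rewrite !Hg; ring.
have -> : e * (b - a) = e * (b - x) + e * (x - a) by ring.
apply: (le_trans (ler_normB _ _)); rewrite !normrM normrN.
by rewrite lerD// ler_pM// ger0_norm ?subr_ge0.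
Qed.

Lemma straddle_derive_cvg G x k (a b : nat -> R) : straddle_derive G x k ->
  (\forall n \near \oo, [/\ 0 <= a n, a n <= x, x <= b n, b n <= 1 & a n < b n]) ->
  (b n - a n) @[n --> \oo] --> (0 : R) ->
  ((G (b n) - G (a n)) / (b n - a n)) @[n --> \oo] --> k.
Proof.
move=> Gk Hab ba0; apply/cvgrPdist_le => e e0; have [d d0 hd] := Gk _ e0.
move/cvgrPdist_lt: ba0 => /(_ _ d0) ba0.
near=> n.
have [a0 ax xb b1 ab] : [/\ 0 <= a n, a n <= x, x <= b n, b n <= 1 & a n < b n] by near: n.
have ba : 0 < b n - a n by rewrite subr_gt0.
have bad : b n - a n < d.
  have : `|0 - (b n - a n)| < d by near: n.
  by rewrite sub0r normrN gtr0_norm.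
rewrite -(ler_pM2r ba); apply: le_trans (hd _ _ a0 ax xb b1 bad).
rewrite -{2}(gtr0_norm ba) -normrM -normrN mulrBl divfK ?gt_eqF// opprB.
exact: lexx.
Unshelve. all: by end_near. Qed.

(** Pins the kernel exactly where the distribution function is affine, as for a checkerboard copula
    inside a strip: the test interval is centred at [x] and stays in [[a, b]]. *)
Lemma straddle_derive_affine G x k m (a b : R) : 0 <= a -> a < x -> x < b -> b <= 1 ->
  (forall t t', a <= t -> t <= t' -> t' <= b -> G t' - G t = m * (t' - t)) ->
  straddle_derive G x k -> k = m.
Proof.
move=> a0 ax xb b1 Gm Gk; apply/eqP; rewrite -subr_eq0 -normr_eq0 eq_le normr_ge0 andbT.
apply/ler_addgt0Pr => e e0; rewrite add0r; have [d d0 hd] := Gk _ e0.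
(* The quarter keeps the full width [2 * h] strictly below [d]. *)
pose h := Num.min (d / 4) (Num.min (x - a) (b - x)).
have h0 : 0 < h by rewrite !lt_min !subr_gt0 ax xb divr_gt0.
have [h1 [h2 h3]] : h <= d / 4 /\ h <= x - a /\ h <= b - x.
  by split; [|split]; rewrite /h !ge_min lexx ?orbT.
have := hd (x - h) (x + h).
rewrite Gm; [|lra..] => /(_ _ _ _ _ _).
have -> : m * (x + h - (x - h)) - k * (x + h - (x - h)) = (m - k) * (x + h - (x - h)) by ring.
have hh : 0 < x + h - (x - h) by lra.
rewrite normrM (gtr0_norm hh) ler_pM2r// distrC; apply; lra.
Qed.

(** This makes any two kernels of one copula agree almost everywhere at a given height. *)
Lemma straddle_derive_unique G x k k' : 0 < x < 1 ->
  straddle_derive G x k -> straddle_derive G x k' -> k = k'.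
Proof.
move=> /andP[x0 x1] Gk Gk'; apply/eqP; rewrite -subr_eq0 -normr_eq0 eq_le normr_ge0 andbT.
apply/ler_addgt0Pr => e e0; rewrite add0r.
have e2 : 0 < e / 2 by rewrite divr_gt0.
have [d d0 hd] := Gk _ e2; have [d' d0' hd'] := Gk' _ e2.
pose h := Num.min (Num.min (d / 4) (d' / 4)) (Num.min x (1 - x)).
have h0 : 0 < h by rewrite !lt_min subr_gt0 x0 x1 !divr_gt0.
have [h1 [h2 [h3 h4]]] : h <= d / 4 /\ h <= d' / 4 /\ h <= x /\ h <= 1 - x.
  by do ! split; rewrite /h !ge_min lexx ?orbT.
have hh : 0 < x + h - (x - h) by lra.
have A : `|G (x + h) - G (x - h) - k * (x + h - (x - h))| <= e / 2 * (x + h - (x - h)).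
  by apply: hd; lra.
have B : `|G (x + h) - G (x - h) - k' * (x + h - (x - h))| <= e / 2 * (x + h - (x - h)).
  by apply: hd'; lra.
rewrite -(ler_pM2r hh) -{1}(gtr0_norm hh) -normrM.
set w := x + h - (x - h) in hh A B *; set g := G (x + h) - _ in A B.
have -> : (k - k') * w = (g - k' * w) - (g - k * w) by ring.
apply: (le_trans (ler_normB _ _)); lra.
Qed.

Lemma pker_fin_num (K : R.-pker R ~> R) x (U : set R) : measurable U -> K x U \is a fin_num.
Proof.
move=> mU; rewrite ge0_fin_numE//; apply: (@le_lt_trans _ _ 1%E); last exact: ltry.
by rewrite -(@prob_kernel _ _ _ _ _ K x); apply: le_measure; rewrite ?inE.
Qed.

Definition cond_cdf (K : R.-pker R ~> R) x y : R := fine (K x (`[0, y]%classic : set R)).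

Lemma cond_cdfE (K : R.-pker R ~> R) x y : (cond_cdf K x y)%:E = K x (`[0, y]%classic : set R).
Proof. by rewrite fineK// pker_fin_num. Qed.

Lemma cond_cdf_itv (K : R.-pker R ~> R) x y : 0 <= cond_cdf K x y <= 1.
Proof.
rewrite -!lee_fin cond_cdfE measure_ge0/= -(@prob_kernel _ _ _ _ _ K x).
by apply: le_measure; rewrite ?inE.
Qed.

Lemma cond_cdf_mono (K : R.-pker R ~> R) x y y' : y <= y' -> cond_cdf K x y <= cond_cdf K x y'.
Proof.
move=> yy'; rewrite -lee_fin !cond_cdfE; apply: le_measure; rewrite ?inE//.
by move=> t/=; rewrite !in_itv/= => /andP[-> /le_trans]; exact.
Qed.

Lemma measurable_cond_cdf (K : R.-pker R ~> R) y :
  measurable_fun setT (fun x => cond_cdf K x y).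
Proof.
apply/measurable_EFinP; under [X in measurable_fun _ X]eq_fun do rewrite /= cond_cdfE.
exact: measurable_kernel.
Qed.

(** Disintegration over [[0, a]] gives [C a y] as the integral of [K t [0, y]] for [t] from [0] to
    [a]; Lebesgue differentiation recovers the integrand almost everywhere. *)
Lemma markov_kernel_derive (C : R -> R -> R) (K : R.-pker R ~> R) y :
  markov_kernel_of C K -> unitI y ->
  \forall x \ae (@lebesgue_measure R), 0 < x < 1 ->
    straddle_derive (C ^~ y) x (cond_cdf K x y).
Proof.
(* Cutting off outside [[0, 1]] gives a function integrable on the whole line, as [K t] is a
   probability for every real [t]. *)
move=> [mu [[_ muC] muK]] yI; pose f := (cond_cdf K ^~ y) \_ (@unitI R).
have If : lebesgue_measure.-integrable setT (EFin \o f).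
  rewrite /f -restrict_EFin; apply/integrable_restrict => //.
    exact: measurable_unitI.
  rewrite setTI; apply: measurable_bounded_integrable.
  - exact: measurable_unitI.
  - by apply: le_lt_trans (ltry 1); rewrite -lebesgue_unitI.
  - exact: measurable_funTS (measurable_cond_cdf K y).
  - exists 1; split => // M M1 t tI /=; have /andP[? ?] := cond_cdf_itv K t y.
    by rewrite ger0_norm//; lra.
have FC a : unitI a -> C a y = (\int[lebesgue_measure]_(t in `[0, a]) f t)%R.
  move=> aI; apply: EFin_inj; rewrite -muC// muK//; last 2 first.
  - by move=> t; move: aI; rewrite !unitIE /= in_itv/= => /andP[_ a1] /andP[-> /le_trans]; exact.
  - by move=> t; move: yI; rewrite !unitIE /= in_itv/= => /andP[_ a1] /andP[-> /le_trans]; exact.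
  rewrite /Rintegral fineK.
    apply: eq_integral => t; rewrite inE/= in_itv/= => /andP[t0 ta].
    rewrite /f patchE mem_set ?cond_cdfE//.
    by move: aI; rewrite !unitIE t0 => /andP[_]; exact: le_trans.
  apply: integrable_fin_num => //; exact: integrableS If.
have := @FTC1 R f (BLeft 0) _ (open_integrable_locally openT If).
have H a : lebesgue_measure.-integrable [set` Interval (BLeft 0) (BRight a)] (EFin \o f).
  exact: integrableS If.
move=> /(_ H); apply: lebesgue_aeS => x /= hx /andP[x0 x1].
have xI : unitI x by rewrite unitIE !ltW.
have bx : (0%:E < x%:E)%E by rewrite lte_fin.
have [dF Fx] := hx bx.
apply: (is_derive_straddle _ _ _ _ FC xI).
have -> : cond_cdf K x y = f x by rewrite /f patchE mem_set.
by rewrite -Fx derive1E; exact: derivableP.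
Qed.

End KernelDerivative.

(** * Kernel of a checkerboard copula *)

Section Checkerboard.
Context {R : realType}.
Implicit Types (D C : R -> R -> R).

(** Cells to the left of the strip are saturated at [1], cells to the right contribute [0], and only
    the strip's own cell is affine in [t]. *)
Lemma clamp01_strip (N i i' : nat) (t : R) : i%:R <= N%:R * t <= i.+1%:R ->
  clamp01 (N%:R * t - i'%:R) = (i' < i)%N%:R + (i' == i)%:R * (N%:R * t - i%:R).
Proof.
move=> /andP[h1]; rewrite mulrSr => h2; rewrite /clamp01.
have [ii|ii|->] := ltngtP i' i.
- have : (i'.+1%:R : R) <= i%:R by rewrite ler_nat.
  rewrite mulrSr => h; rewrite mul0r addr0 max_r; last by lra.
  by rewrite min_l//; lra.
- have : (i.+1%:R : R) <= i'%:R by rewrite ler_nat.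
  rewrite mulrSr => h; rewrite mul0r addr0 max_l; last by lra.
  by rewrite min_r//; lra.
- rewrite mul1r add0r max_r; last by lra.
  by rewrite min_r//; lra.
Qed.

(** At a grid height the clamps in the second variable are indicators of [j' < j]; only the masses
    over strip [i] vary with [t], and their sum over [j'] telescopes. The values of [D] at height
    [0] remain because [D] is arbitrary. *)
Lemma checkerboard_strip D (N i j : nat) (t t' : R) : (i < N)%N -> (j <= N)%N ->
  i%:R / N%:R <= t -> t <= t' -> t' <= i.+1%:R / N%:R ->
  checkerboard N D t' (j%:R / N%:R) - checkerboard N D t (j%:R / N%:R) =
    N%:R * (D (i.+1%:R / N%:R) (j%:R / N%:R) - D (i%:R / N%:R) (j%:R / N%:R)
      - (D (i.+1%:R / N%:R) (0 / N%:R) - D (i%:R / N%:R) (0 / N%:R))) * (t' - t).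
Proof.
move=> iN jN it tt' t'i.
have N0 : (0 : R) < N%:R by rewrite ltr0n (leq_ltn_trans _ iN).
have strip (z : R) : i%:R / N%:R <= z -> z <= i.+1%:R / N%:R -> i%:R <= N%:R * z <= i.+1%:R.
  move=> h1 h2; apply/andP; split; first by move: h1; rewrite ler_pdivrMr// mulrC.
  by move: h2; rewrite ler_pdivlMr// mulrC.
have ht := strip _ it (le_trans tt' t'i).
have ht' := strip _ (le_trans it tt') t'i.
rewrite /checkerboard -sumrB.
transitivity (\sum_(i' < N) (i' == i :> nat)%:R *
   \sum_(j' < N) (j' < j)%N%:R * cb_mass N D i j' * (N%:R * (t' - t))).
  apply: eq_bigr => i' _; rewrite -sumrB mulr_sumr; apply: eq_bigr => j' _.
  rewrite (clamp01_strip _ _ _ _ ht) (clamp01_strip _ _ _ _ ht').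
  have -> : clamp01 (N%:R * (j%:R / N%:R) - j'%:R) = (j' < j)%N%:R :> R.
    rewrite mulrCA divff ?gt_eqF// mulr1 /clamp01; case: ltnP => jj.
      have : (j'.+1%:R : R) <= j%:R by rewrite ler_nat.
      by rewrite mulrSr => h; rewrite max_r ?min_l//; lra.
    have : (j%:R : R) <= j'%:R by rewrite ler_nat.
    by move=> h; rewrite max_l ?min_r//; lra.
  have [->|_] := eqVneq (i' : nat) i; last by rewrite !mul0r; ring.
  by rewrite !mul1r; ring.
rewrite (bigD1 (Ordinal iN))//= eqxx mul1r [X in _ + X]big1 ?addr0; last first.
  by move=> k /negbTE; rewrite -val_eqE/= => ->; rewrite mul0r.
rewrite -mulr_suml.
pose g k := D (i.+1%:R / N%:R) (k%:R / N%:R) - D (i%:R / N%:R) (k%:R / N%:R).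
have -> : \sum_(k < N) (k < j)%N%:R * cb_mass N D i k = g j - g 0%N.
  rewrite -(telescope_sumr _ (leq0n j)) big_mkord.
  rewrite (big_ord_widen _ (fun k => g k.+1 - g k) jN) [in RHS]big_mkcond/=.
  apply: eq_bigr => k _; case: ltnP => _; last by rewrite mul0r.
  by rewrite mul1r /cb_mass /g; ring.
by rewrite /g; ring.
Qed.

(** Inside a strip the kernel equals [N] times a [D]-volume; exchanging [D] for [C] at the four
    corners costs [e] each, and [C] vanishes at height [0]. *)
Lemma checkerboard_kernel_near C D (K : R.-pker R ~> R) N (e : R) :
  grounded_2increasing C -> (forall u v, unitI u -> unitI v -> `|D u v - C u v| <= e) ->
  markov_kernel_of (checkerboard N D) K ->
  \forall x \ae (@lebesgue_measure R), 0 < x < 1 ->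
    forall i j : nat, (i < N)%N -> (j <= N)%N -> i%:R / N%:R < x < i.+1%:R / N%:R ->
    `|cond_cdf K x (j%:R / N%:R) - N%:R * (C (i.+1%:R / N%:R) (j%:R / N%:R)
        - C (i%:R / N%:R) (j%:R / N%:R))| <= 4 * (N%:R * e).
Proof.
move=> gC DC mK.
have ug m : (0 < N)%N -> (m <= N)%N -> unitI (m%:R / N%:R : R).
  by move=> N0 h; rewrite unitIE divr_ge0//= ler_pdivrMr ?ltr0n// mul1r ler_nat.
(* The conditions on [j] stand inside the almost-everywhere statement so that all natural [j] can be
   intersected at once. *)
have : forall j : nat, \forall x \ae (@lebesgue_measure R), (0 < N)%N -> (j <= N)%N ->
    0 < x < 1 -> straddle_derive (checkerboard N D ^~ (j%:R / N%:R)) x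
      (cond_cdf K x (j%:R / N%:R)).
  move=> j; have [jN|] := boolP ((0 < N)%N && (j <= N)%N); last first.
    move=> h; apply: aeW => x N0 jN.
    by rewrite N0 jN in h.
  have [N0 hj] := andP jN.
  have := markov_kernel_derive _ _ _ mK (ug _ N0 hj).
  by apply: lebesgue_aeS => x h _ _; exact: h.
move/ae_foralln; apply: lebesgue_aeS => x hx x01 i j iN jN /andP[ix xi].
have N0 : (0 < N)%N by rewrite (leq_ltn_trans _ iN).
have Nr : (0 : R) < N%:R by rewrite ltr0n.
have uI m : (m <= N)%N -> unitI (m%:R / N%:R : R) by exact: ug.
have u0 : unitI (0 / N%:R : R) by rewrite mul0r; exact: unitI0.
have := straddle_derive_affine _ _ _ _ _ _ _ ix xi _ _ (hx j N0 jN x01).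
move=> /(_ (N%:R * (D (i.+1%:R / N%:R) (j%:R / N%:R) - D (i%:R / N%:R) (j%:R / N%:R)
      - (D (i.+1%:R / N%:R) (0 / N%:R) - D (i%:R / N%:R) (0 / N%:R))))) ->; last 3 first.
- by rewrite divr_ge0.
- by rewrite ler_pdivrMr// mul1r ler_nat.
- by move=> t t' h1 h2 h3; exact: checkerboard_strip.
have iN' := ltnW iN.
rewrite -mulrBr normrM (gtr0_norm Nr) mulrCA ler_pM2l//.
have := DC _ _ (uI _ iN) (uI _ jN); have := DC _ _ (uI _ iN') (uI _ jN).
have := DC _ _ (uI _ iN) u0; have := DC _ _ (uI _ iN') u0.
have [C0 _ _ _ _] := gC; have := C0 _ (uI _ iN); have := C0 _ (uI _ iN').
rewrite mul0r => -> ->; rewrite !ler_norml => /andP[? ?] /andP[? ?] /andP[? ?] /andP[? ?].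
apply/andP; lra.
Qed.

End Checkerboard.

(** * Conditional quantiles *)

Section Quantile.
Context {R : realType}.
Implicit Types (K : R.-pker R ~> R) (tau x y : R) (C : R -> R -> R).

Let level_set K tau x := [set y | unitI y /\ lee tau%:E (K x (`[0, y]%classic : set R))].

Let level_setE K tau x y : level_set K tau x y = (unitI y /\ tau <= cond_cdf K x y) :> Prop.
Proof. by rewrite /level_set /= -cond_cdfE lee_fin. Qed.

Let level_set_lb K tau x : lbound (level_set K tau x) 0.
Proof. by move=> y [+ _]; rewrite unitIE => /andP[]. Qed.

Lemma cquantile_le K tau x y : unitI y -> tau <= cond_cdf K x y -> cquantile K tau x <= y.
Proof.
move=> yI h; apply: ge_inf; first by exists 0; exact: level_set_lb.
by have := level_setE K tau x y; rewrite /level_set/= => ->.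
Qed.

Lemma cquantile_ge K tau x y : tau <= cond_cdf K x 1 -> cond_cdf K x y < tau ->
  y <= cquantile K tau x.
Proof.
move=> h1 hy; apply: lb_le_inf.
  by exists 1; have := level_setE K tau x 1; rewrite /level_set/= => ->; split => //; exact: unitI1.
move=> z hz; have {hz} : level_set K tau x z by [].
rewrite level_setE => -[_ hz]; rewrite leNgt; apply/negP => /ltW/(cond_cdf_mono K x).
by move=> /(le_trans hz)/le_lt_trans/(_ hy); rewrite ltxx.
Qed.

Lemma cquantile_lt K tau x y : tau <= cond_cdf K x 1 -> cquantile K tau x < y ->
  tau <= cond_cdf K x y.
Proof.
move=> h1 /inf_lt[|z hz zy].
  by exists 1; have := level_setE K tau x 1; rewrite /level_set/= => ->; split => //; exact: unitI1.
have {hz} : level_set K tau x z by [].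
by rewrite level_setE => -[_ hz]; apply: (le_trans hz); apply: cond_cdf_mono; exact: ltW.
Qed.

(** For some [x] the measure [K x] may put mass outside [[0, 1]]. If the level is not reached at
    [1], the infimum is over the empty set, hence [0] by convention. *)
Lemma cquantile_default K tau x : cond_cdf K x 1 < tau -> cquantile K tau x = 0.
Proof.
move=> h; rewrite /cquantile (_ : [set y | _] = set0) ?inf0//.
apply/seteqP; split => // y hy; have {hy} : level_set K tau x y by [].
rewrite level_setE unitIE => -[/andP[_ /(cond_cdf_mono K x)] + hy].
by move=> /(le_trans hy)/le_lt_trans/(_ h); rewrite ltxx.
Qed.

Lemma cquantile_itv K tau x : 0 <= cquantile K tau x <= 1.
Proof.
have [h|h] := leP tau (cond_cdf K x 1); last by rewrite cquantile_default// lexx ler01.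
rewrite cquantile_le ?andbT//; last exact: unitI1.
apply: lb_le_inf; last exact: level_set_lb.
by exists 1; have := level_setE K tau x 1; rewrite /level_set/= => ->; split => //; exact: unitI1.
Qed.

(** The event that the quantile is below [r] is a countable union over rational [q < r] in [[0, 1]]
    at which the level is reached. The two further pieces handle the default value [0] and the case
    [r > 1]. *)
Lemma measurable_cquantile K tau : measurable_fun setT (cquantile K tau).
Proof.
apply: (measurability (@RGenInftyO.G R)); first exact: RGenInftyO.measurableE.
move=> _ [_ [r ->] <-]; rewrite setTI.
have mge y : measurable [set x | tau <= cond_cdf K x y].
  have := measurable_cond_cdf K y measurableT `[tau, +oo[%classic (measurable_itv _).
  rewrite setTI; congr measurable; apply/seteqP.
  by split=> x /=; rewrite in_itv/= andbT.
pose F (q : rat) : set R := if (0 <= (ratr q : R) <= 1) && ((ratr q : R) < r) then [set x | tau <= cond_cdf K x (ratr q)]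
  else set0.
rewrite (_ : _ @^-1` _ = (if 0 < r then ~` [set x | tau <= cond_cdf K x 1] else set0) `|`
   ((if 1 < r then [set x | tau <= cond_cdf K x 1] else set0) `|`
   ([set x | tau <= cond_cdf K x 1] `&` \bigcup_q F q))); last first.
  apply/seteqP; split => x /=; rewrite in_itv/=.
  - move=> Qr; have [h|h] := leP tau (cond_cdf K x 1); last first.
      left; move: Qr; rewrite cquantile_default// => -> /=; apply/negP.
      by rewrite -ltNge.
    right; have [r1|r1] := ltP 1 r; [by left|right].
    have [q /[!in_itv]/= /andP[Qq qr]] := rat_in_itvoo Qr.
    split => //; exists q => //; rewrite /F qr (le_trans _ (ltW Qq)) ?(le_trans (ltW qr))//=.
      exact: cquantile_lt.
    by have /andP[] := cquantile_itv K tau x.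
  - move=> [|[|[h [q _]]]].
    + case: ifP => // r0 /= /negP; rewrite -ltNge => /cquantile_default -> //.
    + case: ifP => // r1 _; apply: le_lt_trans r1.
      by have /andP[] := cquantile_itv K tau x.
    + rewrite /F; case: ifP => // /andP[q01 qr] /= hq; apply: le_lt_trans qr.
      by apply: cquantile_le => //; rewrite unitIE.
apply: measurableU; first by case: ifP => // _; exact: measurableC.
apply: measurableU; first by case: ifP.
apply: measurableI => //; apply: bigcupT_measurable_rat => q.
by rewrite /F; case: ifP.
Qed.

End Quantile.

(** * Convergence of quantiles at a fixed point *)

Section QuantileConvergence.
Context {R : realType}.

(** The largest grid point not above [y'] is less than [1 / N] away from it. *)
Lemma grid_between (N : nat) (y y' : R) : 0 <= y -> y' <= 1 -> 0 < N%:R * (y' - y) - 1 ->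
  exists2 j : nat, (j <= N)%N & y <= j%:R / N%:R <= y'.
Proof.
move=> y0 y1 h.
have N0 : (0 : R) < N%:R.
  by rewrite lt_neqAle ler0n andbT; apply/eqP => N0; move: h; rewrite -N0 mul0r; lra.
have yy : 0 < y' - y by rewrite -(pmulr_rgt0 _ N0); lra.
have Ny : 0 <= N%:R * y' by rewrite mulr_ge0//; lra.
have /andP[j1 j2] := truncn_itv Ny; set j := Num.truncn _ in j1 j2.
exists j.
  rewrite -(ler_nat R); apply: (le_trans j1).
  by rewrite -[leRHS]mulr1 ler_pM2l.
rewrite ler_pdivlMr// ler_pdivrMr// ![_ * N%:R]mulrC j1 andbT.
by move: j2; rewrite mulrSr => j2; lra.
Qed.

(** Deterministic core at one irrational [x]. Rational heights give convergence of difference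
    quotients, grid heights give the kernels [Kn]; the two are compared by placing a grid height
    between two rationals. *)
Lemma cquantile_cvg (C : R -> R -> R) (K : R.-pker R ~> R) (tau x : R)
    (N : nat -> nat) (e : nat -> R) (Kn : nat -> R.-pker R ~> R) :
  grounded_2increasing C -> 0 < tau < 1 -> 0 < x < 1 ->
  (forall q : rat, x != ratr q) ->
  (forall q : rat, unitI (ratr q : R) -> straddle_derive (C ^~ (ratr q)) x (cond_cdf K x (ratr q))) ->
  (forall q : rat, unitI (ratr q : R) -> cond_cdf K x (ratr q) != tau) ->
  ((N n)%:R : R) @[n --> \oo] --> +oo ->
  ((N n)%:R * e n) @[n --> \oo] --> (0 : R) ->
  (\forall n \near \oo, forall i j : nat, (i < N n)%N -> (j <= N n)%N ->
     i%:R / (N n)%:R < x < i.+1%:R / (N n)%:R ->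
    `|cond_cdf (Kn n) x (j%:R / (N n)%:R) - (N n)%:R * (C (i.+1%:R / (N n)%:R) (j%:R / (N n)%:R)
        - C (i%:R / (N n)%:R) (j%:R / (N n)%:R))| <= 4 * ((N n)%:R * e n)) ->
  cquantile (Kn n) tau x @[n --> \oo] --> cquantile K tau x.
Proof.
move=> gC /andP[t0 t1] /andP[x0 x1] xQ Cder Kneq Noo Ne0 Hn.
pose i n := Num.truncn ((N n)%:R * x).
have Ngt (M : R) : \forall n \near \oo, M < (N n)%:R.
  by move/cvgryPgt : Noo; apply.
have [_ _ C1r _ inc] := gC.
have Hi : \forall n \near \oo, [/\ (0 : R) < (N n)%:R, (i n < N n)%N &
    (i n)%:R / (N n)%:R < x < (i n).+1%:R / (N n)%:R].
  near=> n.
  have Nn0 : (0 : R) < (N n)%:R by near: n; exact: Ngt.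
  have Nx : 0 <= (N n)%:R * x by rewrite mulr_ge0 ?ltW.
  have /andP[i1 i2] := truncn_itv Nx; rewrite -/(i n) in i1 i2.
  split => //.
    by rewrite -(ltr_nat R); apply: (le_lt_trans i1); rewrite -[ltRHS]mulr1 ltr_pM2l.
  (* Truncation gives only a weak inequality on the left; irrationality of [x] makes it strict, so
     [x] is never on a cell boundary. *)
  rewrite ltr_pdivlMr// [x * _]mulrC i2 andbT lt_neqAle ler_pdivrMr// [x * _]mulrC i1 andbT.
  have := xQ ((i n)%:Q / (N n)%:Q); rewrite fmorph_div/= !ratr_int eq_sym.
  by rewrite -!pmulrn.
(* [C] at height [1] is the identity, whose slope is [1]. *)
have C1 : cond_cdf K x 1 = 1.
  apply: (straddle_derive_affine (C ^~ 1) x _ 1 0 1) => //.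
    move=> t t' h1 h2 h3; rewrite !C1r ?mul1r// unitIE; lra.
  have := Cder 1; rewrite rmorph1; apply; exact: unitI1.
pose G y n := (C ((i n).+1%:R / (N n)%:R) y - C ((i n)%:R / (N n)%:R) y) * (N n)%:R.
have len n : (0 : R) < (N n)%:R ->
    (i n).+1%:R / (N n)%:R - (i n)%:R / (N n)%:R = (N n)%:R^-1 :> R.
  by move=> Nn0; rewrite mulrSr mulrDl mul1r; ring.
have Gcvg q : unitI (ratr q : R) -> G (ratr q) n @[n --> \oo] --> cond_cdf K x (ratr q).
  move=> qI.
  pose a n : R := (i n)%:R / (N n)%:R; pose b n : R := (i n).+1%:R / (N n)%:R.
  have Hab : \forall n \near \oo, [/\ 0 <= a n, a n <= x, x <= b n, b n <= 1 & a n < b n].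
    apply: filterS Hi => n [Nn0 iN /andP[ix xi]].
    split; rewrite ?(ltW ix) ?(ltW xi) ?divr_ge0//.
      by rewrite ler_pdivrMr// mul1r ler_nat.
    exact: lt_trans xi.
  have ba0 : b n - a n @[n --> \oo] --> (0 : R).
    apply/cvgrPdist_lt => d d0; near=> n.
    have Nn0 : (0 : R) < (N n)%:R by near: n; exact: Ngt.
    have Nd : d^-1 < (N n)%:R by near: n; exact: Ngt.
    by rewrite len// sub0r normrN gtr0_norm ?invr_gt0// invf_plt.
  apply: cvg_trans (straddle_derive_cvg _ _ _ a b (Cder q qI) Hab ba0).
  apply: near_eq_cvg; near=> n.
  have Nn0 : (0 : R) < (N n)%:R by near: n; exact: Ngt.
  by rewrite /G len// invrK.
have e4 : (4 * ((N n)%:R * e n)) @[n --> \oo] --> (0 : R).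
  by rewrite -[X in _ --> X](mulr0 4); apply: cvgMr.
have bound : \forall n \near \oo, forall j : nat, (j <= N n)%N ->
    `|cond_cdf (Kn n) x (j%:R / (N n)%:R) - G (j%:R / (N n)%:R) n| <= 4 * ((N n)%:R * e n).
  by apply: filterS2 Hi Hn => n [Nn0 iN hx] h j jN; rewrite /G [X in _ - X]mulrC; exact: (h (i n) j iN jN hx).
have gridI n (j : nat) : (j <= N n)%N -> (0 : R) < (N n)%:R -> unitI (j%:R / (N n)%:R : R).
  by move=> jN Nn0; rewrite unitIE divr_ge0//= ler_pdivrMr// mul1r ler_nat.
have Gmono : \forall n \near \oo, forall y y', unitI y -> unitI y' -> y <= y' -> G y n <= G y' n.
  apply: filterS Hi => n [Nn0 iN /andP[ix xi]] y y' yI yI' yy'.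
  have := inc _ _ _ _ (gridI n (i n) (ltnW iN) Nn0) (gridI n (i n).+1 iN Nn0) yI yI' _ yy'.
  by move=> /(_ (ltW (lt_trans ix xi))) h; rewrite ler_wpM2r// ltW.
(* The level is eventually reached at [1], so the quantile of [Kn] is not the default [0]. The
   height [1] is written as [N / N] to make it a grid height. *)
have Kn1 : \forall n \near \oo, tau <= cond_cdf (Kn n) x 1.
  have t1' : 0 < 1 - tau by rewrite subr_gt0.
  near=> n.
  have Nn0 : (0 : R) < (N n)%:R by near: n; exact: Ngt.
  have b : `|cond_cdf (Kn n) x 1 - G 1 n| <= 4 * ((N n)%:R * e n).
    rewrite -[X in cond_cdf _ _ X](@divff _ ((N n)%:R : R)) ?gt_eqF//.
    rewrite -[X in G X](@divff _ ((N n)%:R : R)) ?gt_eqF//.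
    by move: (leqnn (N n)); near: n; apply: filterS bound => n h; exact: h.
  have [_ iN _] : [/\ (0 : R) < (N n)%:R, (i n < N n)%N &
      (i n)%:R / (N n)%:R < x < (i n).+1%:R / (N n)%:R] by near: n.
  have G1 : G 1 n = 1.
    by rewrite /G !C1r ?len ?mulVf ?gt_eqF//; apply: gridI => //; exact: ltnW.
  have h4 : `|0 - 4 * ((N n)%:R * e n)| < 1 - tau.
    by near: n; move/cvgrPdist_lt: e4; apply.
  move: b h4; rewrite G1 sub0r normrN ler_norml ltr_norml => /andP[? ?] /andP[? ?]; lra.
set q := cquantile K tau x.
have /andP[q0 q1] : 0 <= q <= 1 by exact: cquantile_itv.
have K1 : tau <= cond_cdf K x 1 by rewrite C1 ltW.
apply/cvgrPdist_le => eps eps0.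
have e4lt d : 0 < d -> \forall n \near \oo, `|4 * ((N n)%:R * e n)| < d.
  by move=> d0; move/cvgr0Pnorm_lt: e4; apply.
have Glt r d : unitI (ratr r : R) -> 0 < d ->
    \forall n \near \oo, `|cond_cdf K x (ratr r) - G (ratr r) n| < d.
  by move=> rI d0; move/cvgrPdist_lt: (Gcvg _ rI); apply.
have upper : \forall n \near \oo, cquantile (Kn n) tau x <= q + eps.
  have [q1e|qe1] := leP 1 (q + eps).
    near=> n; apply: le_trans q1e.
    by have /andP[] := cquantile_itv (Kn n) tau x.
  have /rat_in_itvoo[r /[!in_itv]/= /andP[qr re]] : q < q + eps by rewrite ltrDl.
  have [r' /[!in_itv]/= /andP[rr' r'e]] := rat_in_itvoo re.
  have rI : unitI (ratr r : R) by rewrite unitIE; apply/andP; lra.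
  (* The definition of the quantile gives a weak inequality to the right of [q]; the absence of a
     plateau at rational abscissae makes it strict. *)
  have rK : tau < cond_cdf K x (ratr r).
    rewrite lt_neqAle cquantile_lt// andbT eq_sym; exact: Kneq.
  (* One half of the margin absorbs the convergence of [G], the other the distance from [Kn] to
     [G]. *)
  pose gap := (cond_cdf K x (ratr r) - tau) / 2.
  have gap0 : 0 < gap by rewrite divr_gt0// subr_gt0.
  have step n : (0 : R) < (N n)%:R -> (ratr r' - ratr r)^-1 < ((N n)%:R : R) ->
      (forall j : nat, (j <= N n)%N ->
        `|cond_cdf (Kn n) x (j%:R / (N n)%:R) - G (j%:R / (N n)%:R) n| <= 4 * ((N n)%:R * e n)) ->
      (forall y y', unitI y -> unitI y' -> y <= y' -> G y n <= G y' n) ->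
      `|4 * ((N n)%:R * e n)| < gap -> `|cond_cdf K x (ratr r) - G (ratr r) n| < gap ->
      cquantile (Kn n) tau x <= q + eps.
    move=> Nn0 Nr hb hG h4 hg.
    have [j jN /andP[rj jr]] : exists2 j : nat, (j <= N n)%N & (ratr r : R) <= j%:R / (N n)%:R <= (ratr r' : R).
      apply: grid_between; [lra|lra|].
      by rewrite subr_gt0 -ltr_pdivrMr ?subr_gt0// mul1r.
    apply: (@le_trans _ _ (j%:R / (N n)%:R)); last by lra.
    have jI := gridI n j jN Nn0; apply: cquantile_le => //.
    move: (hb _ jN) (hG _ _ rI jI rj) h4 hg; rewrite ler_norml !ltr_norml /gap.
    move=> /andP[? ?] ? /andP[? ?] /andP[? ?]; lra.
  near=> n; apply: step; near: n; [exact: Ngt|exact: Ngt|exact: bound|exact: Gmono|exact: e4lt|].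
  exact: Glt.
have lower : \forall n \near \oo, q - eps <= cquantile (Kn n) tau x.
  have [qe|qe] := leP q eps.
    near=> n; apply: (@le_trans _ _ 0); first by lra.
    by have /andP[] := cquantile_itv (Kn n) tau x.
  have /rat_in_itvoo[r /[!in_itv]/= /andP[re rq]] : q - eps < q by rewrite gtrDl oppr_lt0.
  have [r' /[!in_itv]/= /andP[rr' r'q]] := rat_in_itvoo rq.
  have rI' : unitI (ratr r' : R) by rewrite unitIE; apply/andP; lra.
  (* To the left of [q] strictness follows from the infimum itself. *)
  have rK : cond_cdf K x (ratr r') < tau.
    rewrite ltNge; apply/negP => /(cquantile_le K tau x _ rI'); rewrite -/q; lra.
  pose gap := (tau - cond_cdf K x (ratr r')) / 2.
  have gap0 : 0 < gap by rewrite divr_gt0// subr_gt0.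
  have step n : (0 : R) < (N n)%:R -> (ratr r' - ratr r)^-1 < ((N n)%:R : R) ->
      (forall j : nat, (j <= N n)%N ->
        `|cond_cdf (Kn n) x (j%:R / (N n)%:R) - G (j%:R / (N n)%:R) n| <= 4 * ((N n)%:R * e n)) ->
      (forall y y', unitI y -> unitI y' -> y <= y' -> G y n <= G y' n) ->
      `|4 * ((N n)%:R * e n)| < gap -> `|cond_cdf K x (ratr r') - G (ratr r') n| < gap ->
      tau <= cond_cdf (Kn n) x 1 -> q - eps <= cquantile (Kn n) tau x.
    move=> Nn0 Nr hb hG h4 hg hKn1.
    have [j jN /andP[rj jr]] : exists2 j : nat, (j <= N n)%N & (ratr r : R) <= j%:R / (N n)%:R <= (ratr r' : R).
      apply: grid_between; [lra|lra|].
      by rewrite subr_gt0 -ltr_pdivrMr ?subr_gt0// mul1r.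
    apply: (@le_trans _ _ (j%:R / (N n)%:R)); first by lra.
    have jI := gridI n j jN Nn0; apply: cquantile_ge => //.
    move: (hb _ jN) (hG _ _ jI rI' jr) h4 hg; rewrite ler_norml !ltr_norml /gap.
    move=> /andP[? ?] ? /andP[? ?] /andP[? ?]; lra.
  near=> n; apply: step; near: n; [exact: Ngt|exact: Ngt|exact: bound|exact: Gmono|exact: e4lt|exact: Glt|].
  exact: Kn1.
apply: filterS2 upper lower => n u l; rewrite ler_norml; apply/andP; lra.
Unshelve. all: by end_near. Qed.

End QuantileConvergence.

(** * Exceptional quantile levels *)

Section Exceptional.
Context {R : realType}.

Lemma countable_atoms d (T : measurableType d) (P : probability T R) (f : T -> R) :
  measurable_fun setT f -> countable [set r | P (f @^-1` [set r]) != 0%E].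
Proof.
move=> mf.
have mr r : measurable (f @^-1` [set r]) by rewrite -[_ @^-1` _]setTI; exact: mf.
pose X : {RV P >-> R} := mfun_Sub (mem_set mf).
apply: sub_countable (pmf_gt0_countable X); apply: subset_card_le => r /= h.
rewrite /pmf/= fine_gt0// lt0e h measure_ge0/=.
by apply: le_lt_trans (ltry 1); exact: probability_le1.
Qed.

(* A plateau of [K(x, [0, .])] at height [tau] contains a rational abscissa, so outside these
   levels almost every [x] has a unique [tau]-quantile. *)
Definition exceptional_levels (K : R.-pker R ~> R) : set R :=
  \bigcup_(q : rat) [set tau | lebesgue_measure
     ([set x | cond_cdf K x (ratr q) = tau] `&` @unitI R) != 0%E].

(** Lebesgue measure on [[0, 1]] is the first marginal of [mu], so for each rational [q] the
    excluded levels are atoms of a random variable under [mu]. *)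
Lemma countable_exceptional_levels (C : R -> R -> R) (K : R.-pker R ~> R) :
  is_copula C -> countable (exceptional_levels K).
Proof.
move=> [mu [_ muB]]; apply: bigcup_countable => // q _.
have mf : measurable_fun setT (fun z : R * R => cond_cdf K z.1 (ratr q)).
  exact: measurableT_comp (measurable_cond_cdf K (ratr q)) measurable_fst.
apply: sub_countable (countable_atoms _ _ mu _ mf); apply: subset_card_le => tau /=.
have mA : measurable [set x | cond_cdf K x (ratr q) = tau].
  by rewrite -[X in measurable X]setTI; exact: (measurable_cond_cdf K (ratr q) measurableT [set tau]).
rewrite -(proj1 (muB _ mA)).
rewrite (_ : _ @^-1` _ = [set x | cond_cdf K x (ratr q) = tau] `*` setT)//.
by apply/seteqP; split=> -[x y] //= [].
Qed.

Lemma lebesgue_ae_rat (Q : rat -> R -> Prop) :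
  (forall q, \forall x \ae (@lebesgue_measure R), Q q x) ->
  \forall x \ae (@lebesgue_measure R), forall q, Q q x.
Proof.
move=> H.
have : forall n : nat, \forall x \ae (@lebesgue_measure R),
    if unpickle n is Some q then Q q x else True.
  by move=> n; case: unpickle => [q|]; [exact: H|exact: aeW].
by move/ae_foralln; apply: lebesgue_aeS => x h q; have := h (pickle q); rewrite pickleK.
Qed.

Lemma lebesgue_aeI (A B : R -> Prop) : (\forall x \ae (@lebesgue_measure R), A x) ->
  (\forall x \ae (@lebesgue_measure R), B x) -> \forall x \ae (@lebesgue_measure R), A x /\ B x.
Proof. by apply: filterS2; first exact: (ae_filter_ringOfSetsType lebesgue_measure). Qed.

Lemma lebesgue_ae_neq (a : R) : \forall x \ae (@lebesgue_measure R), x != a.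
Proof.
exists [set a]; split => //; first exact: lebesgue_measure_set1.
by move=> x /= /negP; rewrite negbK => /eqP.
Qed.

(** The levels are defined from one fixed kernel [K0]; they serve every kernel [K] of [C], because
    both are derivatives of the same function at each rational height. *)
Lemma ae_level_neq (C : R -> R -> R) (K0 K : R.-pker R ~> R) (tau : R) :
  markov_kernel_of C K0 -> markov_kernel_of C K -> ~ exceptional_levels K0 tau ->
  \forall x \ae (@lebesgue_measure R), 0 < x < 1 -> forall q : rat, unitI (ratr q : R) ->
    cond_cdf K x (ratr q) != tau.
Proof.
move=> hK0 hK ntau.
have : \forall x \ae (@lebesgue_measure R), forall q : rat, 0 < x < 1 -> unitI (ratr q : R) ->
    cond_cdf K x (ratr q) != tau.
  apply: lebesgue_ae_rat => q.
  have [qI|nqI] := pselect (unitI (ratr q : R)); last by apply: aeW.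
  have mA : measurable ([set x | cond_cdf K0 x (ratr q) = tau] `&` @unitI R).
    apply: measurableI; last exact: measurable_unitI.
    by rewrite -[X in measurable X]setTI; exact: (measurable_cond_cdf K0 (ratr q) measurableT [set tau]).
  have N0 : \forall x \ae (@lebesgue_measure R), ~ (cond_cdf K0 x (ratr q) = tau /\ unitI x).
    exists ([set x | cond_cdf K0 x (ratr q) = tau] `&` @unitI R); split => //.
      by apply/eqP; apply: contrapT => /negP h; apply: ntau; exists q.
    by move=> x /= /contrapT.
  have := lebesgue_aeI _ _ N0 (lebesgue_aeI _ _ (markov_kernel_derive _ _ _ hK0 qI)
     (markov_kernel_derive _ _ _ hK qI)).
  apply: lebesgue_aeS => x [h0 [h1 h2]] x01 _.
  rewrite (straddle_derive_unique _ _ _ _ x01 (h2 x01) (h1 x01)).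
  apply/eqP => h; apply: h0; split => //; rewrite unitIE.
  by case/andP: x01 => *; rewrite !ltW.
by apply: lebesgue_aeS => x h x01 q qI; exact: h.
Qed.

End Exceptional.

(** * Powers of [n] and convergence of norms *)

Section PowerLimits.
Context {R : realType}.

Lemma powR_nat_gt (a M : R) : 0 < a -> \forall n \near \oo, M < (n%:R : R) `^ a.
Proof.
move=> a0; near=> n; pose L := Num.max M 1.
have L0 : 0 <= L by rewrite le_max ler01 orbT.
have : L `^ a^-1 < n%:R by near: n; exact: nbhs_infty_gtr.
move=> h; apply: (@le_lt_trans _ _ L); first by rewrite le_max lexx.
have -> : L = (L `^ a^-1) `^ a by rewrite -powRrM mulVf ?gt_eqF// powRr1.
by rewrite gt0_ltr_powR// nnegrE ?powR_ge0.
Unshelve. all: by end_near. Qed.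

Lemma powRN_nat_cvg0 (a : R) : 0 < a -> ((n%:R : R) `^ (- a)) @[n --> \oo] --> (0 : R).
Proof.
move=> a0; apply/cvgr0Pnorm_lt => e e0; near=> n.
have h : e^-1 < (n%:R : R) `^ a by near: n; exact: powR_nat_gt.
have na : 0 < (n%:R : R) `^ a by apply: lt_trans h; rewrite invr_gt0.
by rewrite powRN gtr0_norm ?invr_gt0// invf_plt.
Unshelve. all: by end_near. Qed.

Lemma Nfloor_le (s : R) n : (Nfloor s n)%:R <= (n%:R : R) `^ s.
Proof. by rewrite truncn_le powR_ge0. Qed.

Lemma Nfloor_cvgy (s : R) : 0 < s -> ((Nfloor s n)%:R : R) @[n --> \oo] --> +oo.
Proof.
move=> s0; apply/cvgryPgt => M; near=> n.
have h : M + 1 < (n%:R : R) `^ s by near: n; exact: powR_nat_gt.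
have /andP[_ h2] := truncn_itv (powR_ge0 (n%:R : R) s).
by move: h2; rewrite /Nfloor mulrSr; lra.
Unshelve. all: by end_near. Qed.

(** As [1 / n <= n ^ (- r)], the second factor is at most [(3 * (1 + 3) + 2) * n ^ (- r)], whence
    the constant [14]; the first is at most [n ^ s]. *)
Lemma Nfloor_rate (s r : R) : 0 < s < r -> r < 2^-1 ->
  ((Nfloor s n)%:R * (3 * ((n%:R : R) `^ (- r) + 3 / n%:R) + 2 / n%:R)) @[n --> \oo] --> (0 : R).
Proof.
move=> /andP[s0 sr] r2.
have lim : (14 * (n%:R : R) `^ (- (r - s))) @[n --> \oo] --> (0 : R).
  by rewrite -[X in _ --> X](mulr0 14); apply: cvgMr; apply: powRN_nat_cvg0; rewrite subr_gt0.
apply: (squeeze_cvgr _ (cvg_cst 0) lim); near=> n.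
have n0 : (0 < n)%N by near: n; exact: nbhs_infty_gt.
have n1 : (1 : R) <= n%:R by rewrite ler1n.
have np : (0 : R) < n%:R by rewrite ltr0n.
have rge : (n%:R : R)^-1 <= n%:R `^ (- r).
  by rewrite -[X in X^-1]powRr1 ?(ltW np)// -powRN ler_powR//; lra.
have r0 := powR_ge0 (n%:R : R) (- r).
have i0 : 0 <= (n%:R : R)^-1 by rewrite invr_ge0 ltW.
have s0' := powR_ge0 (n%:R : R) s.
apply/andP; split; first by rewrite mulr_ge0//; lra.
have -> : - (r - s) = s + - r by ring.
rewrite powRD; last by rewrite (gt_eqF np) implybT.
rewrite mulrCA; apply: ler_pM => //; [exact: Nfloor_le|lra].
Unshelve. all: by end_near. Qed.

Lemma cvg0_powR (u : nat -> R) (a : R) : 0 < a -> (forall n, 0 <= u n) ->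
  u n @[n --> \oo] --> (0 : R) -> (u n `^ a) @[n --> \oo] --> (0 : R).
Proof.
move=> a0 u0 uc; apply/cvgr0Pnorm_le => e e0; near=> n.
have h : `|u n| <= e `^ a^-1 by near: n; move/cvgr0Pnorm_le: uc; apply; exact: powR_gt0.
rewrite ger0_norm ?powR_ge0//; rewrite ger0_norm// in h.
have -> : e = (e `^ a^-1) `^ a by rewrite -powRrM mulVf ?gt_eqF// powRr1// ltW.
by apply: ge0_ler_powR => //; rewrite ?nnegrE ?powR_ge0// ltW.
Unshelve. all: by end_near. Qed.

Lemma Lp_norm_cvg0 (p : R) (f : nat -> R -> R) : 1 <= p ->
  (forall n, measurable_fun setT (f n)) -> (forall n x, `|f n x| <= 1) ->
  (\forall x \ae (@lebesgue_measure R), unitI x -> f n x @[n --> \oo] --> (0 : R)) ->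
  Lp_norm p (f n) @[n --> \oo] --> (0 : \bar R).
Proof.
move=> p1 mf f1 fae; have p0 : 0 < p by lra.
pose I n := (\int[lebesgue_measure]_(x in @unitI R) (`|f n x| `^ p)%:E)%E.
have I0 n : (0 <= I n)%E.
  by apply: integral_ge0 => x _; rewrite lee_fin powR_ge0.
have [] := @dominated_convergence _ _ R (@lebesgue_measure R) (@unitI R) measurable_unitI
   (fun n x => (`|f n x| `^ p)%:E) (cst 0%E) (cst 1%E).
- move=> n; apply/measurable_EFinP; apply: measurable_funTS.
  apply: (measurableT_comp (measurable_powR p)).
  exact: (measurableT_comp (@normr_measurable R setT) (mf n)).
- exact: measurable_cst.
- apply: lebesgue_aeS fae => x h xI; apply: cvg_EFin; first exact: nearW.
  apply: cvg0_powR => //; apply/cvgr0Pnorm_lt => e e0.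
  have /cvgr0Pnorm_lt/(_ _ e0) := h xI.
  by apply: filterS => n; rewrite normr_id.
- apply/integrableP; split; first exact: measurable_cst.
  have := lebesgue_unitI; rewrite integral_cst/=; last exact: measurable_unitI.
  by rewrite normr1 mul1e => ->; rewrite ltry.
- apply: aeW => x n _; rewrite gee0_abs ?lee_fin ?powR_ge0//.
  have -> : 1 = 1 `^ p :> R by rewrite powR1.
  by apply: ge0_ler_powR; rewrite ?nnegrE ?normr_ge0//; lra.
move=> _ _; rewrite integral0 => Icvg.
have {}Icvg : I n @[n --> \oo] --> (0%:E : \bar R) by exact: Icvg.
(* The integrals are eventually finite, so the root [p^-1] can be taken in the reals. *)
have /fine_cvgP[Ifin Ic] := Icvg.
apply/fine_cvgP; split.
  apply: filterS Ifin => n hn; rewrite /Lp_norm -/(I n) -(fineK hn) poweR_EFin//.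
have rc : (fine (I n) `^ p^-1) @[n --> \oo] --> (0 : R).
  by apply: cvg0_powR => [|n|]; rewrite ?invr_gt0// fine_ge0.
apply: cvg_trans rc; apply: near_eq_cvg; apply: filterS Ifin => n hn.
by rewrite /= /Lp_norm -/(I n) -(fineK hn) poweR_EFin.
Qed.

End PowerLimits.

(** * Almost sure uniform rate for the empirical copula *)

Section EmpiricalRate.
Context {R : realType} {d : measure_display} {Omega : measurableType d}
  (P : probability Omega R) (C : R -> R -> R) (X : nat -> Omega -> R * R).
Hypothesis gC : grounded_2increasing C.
Hypothesis iidX : iid_with_df P X C.

(** The quadrant at [(1, 1)] has probability [C 1 1 = 1]. *)
Lemma ae_sample_le1 : {ae P, forall w, forall k, (X k w).1 <= 1 /\ (X k w).2 <= 1}.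
Proof.
have [mX [_ PX]] := iidX; apply: ae_foralln => k.
have mA : measurable (X k @^-1` quadrant 1 1).
  by rewrite -[X in measurable X]setTI; apply: mX => //; exact: measurable_quadrant.
exists (~` (X k @^-1` quadrant 1 1)); split => //; first exact: measurableC.
transitivity (1 - P (X k @^-1` quadrant 1 1))%E; first exact: probability_setC.
have -> : P (X k @^-1` quadrant 1 1) = (C 1 1)%:E := PX k 1 1 unitI1 unitI1.
by have [_ _ C1 _ _] := gC; rewrite (C1 _ unitI1) subee.
Qed.

Lemma ae_emp_copula_rate (r : R) : 0 < r < 2^-1 ->
  {ae P, forall w, \forall n \near \oo, forall u v, unitI u -> unitI v ->
    `|emp_copula (X^~ w) n u v - C u v|
      <= 3 * ((n%:R : R) `^ (- r) + 3 / n%:R) + 2 / n%:R}.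
Proof.
move=> r01; have := ae_sample_le1; have := ae_grid_deviation _ _ _ iidX _ r01.
apply: filterS2 => w hgrid hw; near=> n => u v uI vI.
have n0 : (0 < n)%N by near: n; exact: nbhs_infty_gt.
apply: (emp_copula_dist _ _ _ _ gC n0 hw) => // u' v' u'I v'I.
apply: le_lt_trans (emp_count_deviation _ _ _ ((n%:R : R) `^ (- r)) gC n0 _ _ _ u'I v'I) _.
  by near: n.
(* The deviation bound carries [2 / n]; raising it to [3 / n] yields the strict inequality that the
   rank argument requires. *)
by rewrite ltrD2l ltr_pM2r ?invr_gt0 ?ltr0n// ltr_nat.
Unshelve. all: by end_near. Qed.

End EmpiricalRate.

Theorem theorem25 (R : realType) (d : measure_display) (Omega : measurableType d)
  (P : probability Omega R) (C : R -> R -> R) (X : nat -> Omega -> R * R) (s : R) :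
  is_copula C ->
  iid_with_df P X C ->
  0 < s < 2^-1 ->
  exists T : set R, countable T /\ T `<=` (`]0, 1[ : set R) /\
    forall tau : R, 0 < tau < 1 -> ~ T tau ->
    forall K : R.-pker R ~> R, markov_kernel_of C K ->
    \forall w \ae (P : probability Omega R),
      forall Kn : nat -> R.-pker R ~> R,
        (forall n : nat, (0 < n)%N -> markov_kernel_of
           (checkerboard (Nfloor s n) (emp_copula (fun k => X k w) n)) (Kn n)) ->
        (\forall x \ae (@lebesgue_measure R), unitI x ->
           (fun n => cquantile (Kn n) tau x) @ \oo --> cquantile K tau x) /\
        (forall p : R, 1 <= p ->
           (fun n => Lp_norm p (fun x => cquantile (Kn n) tau x - cquantile K tau x))
             @ \oo --> (0 : \bar R)).
Proof.
move=> copC iidX /andP[s0 s12]; have gC := is_copula_grounded _ copC.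
(* The exceptional set must be chosen before the kernel [K], hence it is built from some kernel of
   [C]; without any, the claim is vacuous. *)
have [[K0 hK0]|noK] := pselect (exists K : R.-pker R ~> R, markov_kernel_of C K); last first.
  exists set0; split; first exact: countable0.
  by split => // tau _ _ K hK; exfalso; apply: noK; exists K.
exists (exceptional_levels K0 `&` `]0, 1[%classic); split.
  apply: sub_countable (countable_exceptional_levels _ K0 copC).
  by apply: subset_card_le => t [].
split; first by move=> t [].
move=> tau tau01 nT K hK.
have {}nT : ~ exceptional_levels K0 tau.
  by move=> h; apply: nT; split => //=; rewrite in_itv.
(* Any exponent strictly between [s] and [1/2] works; this is the midpoint. *)
pose r : R := (s + 2^-1) / 2.
have [sr r2] : s < r /\ r < 2^-1 by rewrite /r; split; lra.
have r0 : 0 < r by lra.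
pose e n : R := 3 * ((n%:R : R) `^ (- r) + 3 / n%:R) + 2 / n%:R.
have := ae_emp_copula_rate _ _ _ gC iidX r (introT andP (conj r0 r2)).
(* The almost sure event involves only the sample, so it is fixed before the kernels [Kn] are
   given. *)
apply: filterS => w [n0 _ hn0] Kn hKn.
have near_w n : (n0 <= n)%N -> forall u v, unitI u -> unitI v ->
    `|emp_copula (X^~ w) n u v - C u v| <= e n by move=> n0n; exact: hn0.
(* The threshold [maxn n0 1] combines the start of the rate with [0 < n], where [Kn n] is
   specified. *)
have Kn_near : \forall x \ae (@lebesgue_measure R), forall n : nat, 0 < x < 1 ->
    (maxn n0 1 <= n)%N -> forall i j : nat, (i < Nfloor s n)%N -> (j <= Nfloor s n)%N ->
    i%:R / (Nfloor s n)%:R < x < i.+1%:R / (Nfloor s n)%:R ->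
    `|cond_cdf (Kn n) x (j%:R / (Nfloor s n)%:R) - (Nfloor s n)%:R *
        (C (i.+1%:R / (Nfloor s n)%:R) (j%:R / (Nfloor s n)%:R)
        - C (i%:R / (Nfloor s n)%:R) (j%:R / (Nfloor s n)%:R))| <= 4 * ((Nfloor s n)%:R * e n).
  apply: ae_foralln => n; have [hn|hn] := leqP (maxn n0 1) n; last first.
    exact: aeW.
  have /andP[n0n n1] : (n0 <= n)%N && (0 < n)%N by rewrite -geq_max.
  have := checkerboard_kernel_near _ _ _ _ _ gC (near_w n n0n) (hKn n n1).
  by apply: lebesgue_aeS => x h x01 _; exact: h.
have K_der : \forall x \ae (@lebesgue_measure R), forall q : rat, unitI (ratr q : R) ->
    0 < x < 1 -> straddle_derive (C ^~ (ratr q)) x (cond_cdf K x (ratr q)).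
  apply: lebesgue_ae_rat => q; have [qI|nqI] := pselect (unitI (ratr q : R)); last exact: aeW.
  have := markov_kernel_derive _ _ _ hK qI.
  by apply: lebesgue_aeS => x h _; exact: h.
have irr : \forall x \ae (@lebesgue_measure R), forall q : rat, x != ratr q.
  by apply: lebesgue_ae_rat => q; exact: lebesgue_ae_neq.
have Qcvg : \forall x \ae (@lebesgue_measure R), unitI x ->
    (fun n => cquantile (Kn n) tau x) @ \oo --> cquantile K tau x.
  have := lebesgue_aeI _ _ Kn_near (lebesgue_aeI _ _ K_der (lebesgue_aeI _ _ irr
    (ae_level_neq _ _ _ _ hK0 hK nT))).
  apply: lebesgue_aeS => x [hKn' [hder [hirr hneq]]]; rewrite unitIE => /andP[x0 x1].
  (* The endpoints are rational, so irrationality of [x] excludes them. *)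
  have x01 : 0 < x < 1.
    have h0 := hirr 0; have h1 := hirr 1; rewrite rmorph0 in h0; rewrite rmorph1 in h1.
    by rewrite !lt_neqAle x0 x1 h1 eq_sym h0.
  apply: (cquantile_cvg C K tau x (Nfloor s) e) => //.
  - by move=> q qI; exact: hder.
  - exact: hneq.
  - exact: Nfloor_cvgy.
  - by apply: Nfloor_rate; rewrite ?s0.
  - by exists (maxn n0 1) => // n hn; exact: hKn'.
split=> // p p1.
apply: Lp_norm_cvg0 => //.
- by move=> n; apply: measurable_funB; exact: measurable_cquantile.
- move=> n x; have /andP[? ?] := cquantile_itv (Kn n) tau x.
  by have /andP[? ?] := cquantile_itv K tau x; rewrite ler_norml; apply/andP; lra.
- apply: lebesgue_aeS Qcvg => x h xI; rewrite -(subrr (cquantile K tau x)).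
  by apply: cvgB; [exact: h|exact: cvg_cst].
Qed.
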